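(* Any tame Kuranishi atlas or cobordism $\mathcal K$ has the following Hausdorff, homeomorphism, and linearity properties: (1) The realizations $|\mathcal K|$ and $|\mathbf E_{\mathcal K}|$ are Hausdorff in the quotient topology. (2) For each $I\in\mathcal I_{\mathcal K}$ the projection maps $\pi_{\mathcal K}:U_I\to|\mathcal K|$ and $\pi_{\mathbf E_{\mathcal K}}:U_I\times E_I\to|\mathbf E_{\mathcal K}|$ are homeomorphisms onto their images and fit into a commutative diagram, i.e. $|\mathrm{pr}_{\mathcal K}|\circ\pi_{\mathbf E_{\mathcal K}}=\pi_{\mathcal K}\circ\mathrm{pr}_I$ on $U_I\times E_I$, where $\mathrm{pr}_I:U_I\times E_I\to U_I$ is the projection. (3) The horizontal maps $\pi_{\mathbf E_{\mathcal K}}|_{U_I\times E_I}$, $\pi_{\mathcal K}|_{U_I}$ in this diagram intertwine the vector space structure on $E_I$ with a unique vector space structure on the fibres of $|\mathrm{pr}_{\mathcal K}|$.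
   Context: \textbf{Charts and atlases.} A Kuranishi chart (trivial isotropy) for a compact metrizable $X$ with footprint a nonempty open $F\subset X$ is $\mathbf K=(U,E,s,\psi)$ with $U$ a finite-dimensional smooth manifold (without boundary), $E$ a finite-dimensional real vector space, $s:U\to E$ smooth, $\psi:s^{-1}(0)\to X$ a homeomorphism onto $F$; $\dim\mathbf K=\dim U-\dim E$. A coordinate change $\widehat\Phi_{IJ}:\mathbf K_I\to\mathbf K_J$ ($F_I\cap F_J\neq\emptyset$) consists of an open $U_{IJ}\subset U_I$ with $U_{IJ}\cap s_I^{-1}(0)=\psi_I^{-1}(F_I\cap F_J)$, a smooth embedding $\phi_{IJ}:U_{IJ}\to U_J$ and a linear injection $\widehat\phi_{IJ}:E_I\to E_J$ with $s_J\circ\phi_{IJ}=\widehat\phi_{IJ}\circ s_I$, $\phi_{IJ}=\psi_J^{-1}\circ\psi_I$ on $U_{IJ}\cap s_I^{-1}(0)$, and the index condition: for all $u\in U_{IJ}$, $d_u\phi_{IJ}(\ker d_us_I)=\ker d_{\phi_{IJ}(u)}s_J$, and $E_I=\operatorname{im}d_us_I\oplus C$ implies $E_J=\operatorname{im}d_{\phi_{IJ}(u)}s_J\oplus\widehat\phi_{IJ}(C)$. A Kuranishi atlas $\mathcal K$ of dimension $d$ on $X$ consists of basic charts $\mathbf K_1,\dots,\mathbf K_N$ with footprints covering $X$; with $\mathcal I_{\mathcal K}=\{\emptyset\neq I\subset\{1,\dots,N\}:F_I:=\bigcap_{i\in I}F_i\neq\emptyset\}$, charts $\mathbf K_I$ with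 footprint $F_I$ for $I\in\mathcal I_{\mathcal K}$ ($\mathbf K_{\{i\}}=\mathbf K_i$), all of dimension $d$; and coordinate changes $\widehat\Phi_{IJ}$ for $I\subsetneq J$, such that for $I\subsetneq J\subsetneq L$: $\widehat\phi_{JL}\widehat\phi_{IJ}=\widehat\phi_{IL}$, $\phi_{IJ}^{-1}(U_{JL})\subset U_{IL}$, and $\phi_{JL}\phi_{IJ}=\phi_{IL}$ on $\phi_{IJ}^{-1}(U_{JL})$. Conventions: $U_{II}=U_I$, $\phi_{II}=\mathrm{id}$, $s_J^{-1}(E_I)=s_J^{-1}(\widehat\phi_{IJ}(E_I))$. $\mathcal K$ is tame if it is additive (each map $\prod_{i\in I}E_i\to E_I$, $(e_i)\mapsto\sum\widehat\phi_{iI}(e_i)$ is an isomorphism) and, for all indices (equalities allowed), $U_{IJ}\cap U_{IL}=U_{I(J\cup L)}$ for $I\subset J,L$ (with $U_{IH}=\emptyset$ for $H\notin\mathcal I_{\mathcal K}$) and $\phi_{IJ}(U_{IL})=U_{JL}\cap s_J^{-1}(E_I)$ for $I\subset J\subset L$. \textbf{Realizations.} $|\mathcal K|=\bigsqcup_IU_I/\!\sim$ with $\sim$ generated by $(I,x)\sim(J,\phi_{IJ}(x))$ for $I\subset J$, $x\in U_{IJ}$, and $|\mathbf E_{\mathcal K}|=\bigsqcup_IU_I\times E_I/\!\sim$ with $\sim$ generated by $(I,x,e)\sim(J,\phi_{IJ}(x),\widehat\phi_{IJ}(e))$ for $I\subset J$, $x\in U_{IJ}$, $e\in E_I$; both carry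 the quotient topology, with projections $\pi_{\mathcal K}$, $\pi_{\mathbf E_{\mathcal K}}$, and $|\mathrm{pr}_{\mathcal K}|:|\mathbf E_{\mathcal K}|\to|\mathcal K|$, $[I,x,e]\mapsto[I,x]$. \textbf{Cobordisms.} Let $A^0_\delta=[0,\delta)$, $A^1_\delta=(1-\delta,1]$. A collared cobordism $(Y,\iota_Y^0,\iota_Y^1)$ is a separable, locally compact metrizable space with disjoint (possibly empty) closed subsets $\partial^0Y,\partial^1Y$ and maps $\iota^\alpha_Y:A^\alpha_\varepsilon\times\partial^\alpha Y\to Y$ with $\iota^\alpha_Y(\alpha,\cdot)$ the inclusion, which are homeomorphisms onto disjoint open neighbourhoods of $\partial^\alpha Y$. An open $F\subset Y$ is collared if with $\partial^\alpha F=F\cap\partial^\alpha Y$ one has $F\cap\iota_Y^\alpha(A^\alpha_\delta\times\partial^\alpha Y)=\iota_Y^\alpha(A^\alpha_\delta\times\partial^\alpha F)$ for some $\delta>0$, and $F\cap\operatorname{im}\iota^\alpha_Y=\emptyset$ if $\partial^\alpha F=\emptyset$. A chart with collared boundary for $Y$ is $(U,E,s,\psi)$ with $E$ a finite-dimensional real vector space, $s:U\to E$ smooth, $\psi:s^{-1}(0)\to Y$ a homeomorphism onto an open footprint $F\subset Y$, and $U$ a finite-dimensional smooth manifold with boundary $\partial^0U\sqcup\partial^1U$ with collar diffeomorphisms $\iota^\alpha_U:A^\alpha_\varepsilon\times\partial^\alpha U\to U$ onto neighbourhoods of $\partial^\alpha U$, footprint $F$ collared and meeting some $\partial^\alpha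 Y$, $\partial^\alpha U\ne\emptyset$ iff $\partial^\alpha F\neq\emptyset$, and charts $\partial^\alpha\mathbf K=(\partial^\alpha U,E,s^\alpha,\psi^\alpha)$ for $\partial^\alpha Y$ with footprint $\partial^\alpha F$ such that $s(\iota_U^\alpha(t,x))=s^\alpha(x)$, $\psi(\iota^\alpha_U(t,x))=\iota^\alpha_Y(t,\psi^\alpha(x))$ near the boundary. A coordinate change with collared boundary from such $\mathbf K_I$ to $\mathbf K_J$ (with or without boundary) has collared domain $U_{IJ}$; if $F_J\cap\partial^\alpha Y\neq\emptyset$ it equals, in collar coordinates near the boundary, the product of $\mathrm{id}_{A^\alpha_\varepsilon}$ with a coordinate change $\partial^\alpha\widehat\Phi_{IJ}:\partial^\alpha\mathbf K_I\to\partial^\alpha\mathbf K_J$ of domain $\partial^\alpha U_{IJ}$ (including equality of domains and images in the collars); if $F_J\cap\partial^\alpha Y=\emptyset$ its domain is disjoint from a collar of $\partial^\alpha U_I$. A Kuranishi cobordism on a compact collared cobordism $Y$ is defined as a Kuranishi atlas on $Y$, with charts that have collared boundary or are ordinary charts with footprints precompact in $Y\setminus(\partial^0Y\cup\partial^1Y)$, and coordinate changes of the corresponding type; tameness and realizations are defined as for atlases. *)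

(* Defs.v *)
From HB Require Import structures.
From mathcomp Require Import all_boot all_order all_algebra.
From mathcomp Require Import all_classical all_reals all_analysis.
From Stdlib Require Import Relations.

Set Implicit Arguments.
Unset Strict Implicit.
Unset Printing Implicit Defensive.

Import Order.TTheory GRing.Theory Num.Theory.
Import numFieldNormedType.Exports.
Import VectorInternalTheory.

Local Open Scope classical_set_scope.
Local Open Scope ring_scope.
Local Open Scope quotient_scope.

(** * Topology *)

Definition homeo_onto (T T' : topologicalType) (A : set T) (B : set T')
    (f : T -> T') : Prop :=
  [/\ set_bij A B f, {within A, continuous f} &
      forall O, open O ->
        exists2 O', open O' & f @` (A `&` O) = B `&` O'].

Definition metrizable (R : realType) (T : topologicalType) : Prop :=
  exists dist : T -> T -> R,
    [/\ forall x y, dist x y = 0 <-> x = y,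
        forall x y, dist x y = dist y x,
        forall x y z, dist x z <= dist x y + dist y z &
        forall x, nbhs x =
          filter_from [set e : R | 0 < e] (fun e => [set y | dist x y < e])].
Arguments metrizable R T : clear implicits.

Definition separable (T : topologicalType) : Prop :=
  exists2 S : set T, countable S & dense S.
Arguments separable T : clear implicits.

Definition gen_equivb (T : Type) (r : T -> T -> Prop) (x y : T) : bool :=
  `[< clos_refl_sym_trans T r x y >].

Lemma gen_equivb_equiv (T : Type) (r : T -> T -> Prop) :
  equiv_class_of (gen_equivb r).
Proof.
split.
- by move=> x; apply/asboolP; exact: rst_refl.
- by move=> x y; apply/asboolP/asboolP => h; exact: rst_sym.
- move=> y x z /asboolP h1 /asboolP h2; apply/asboolP; exact: rst_trans h1 h2.
Qed.

Definition gen_equiv (T : Type) (r : T -> T -> Prop) : equiv_rel T :=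
  EquivRelPack (gen_equivb_equiv r).

Definition gen_quotient (T : topologicalType) (r : T -> T -> Prop)
    : topologicalType :=
  quotient_topology {eq_quot gen_equiv r}.

Definition gen_class (T : topologicalType) (r : T -> T -> Prop) (x : T)
    : gen_quotient r :=
  \pi_(quotient_topology {eq_quot gen_equiv r})%qT x.

Lemma gen_classP (T : topologicalType) (r : T -> T -> Prop) (x y : T) :
  gen_class r x = gen_class r y <-> clos_refl_sym_trans T r x y.
Proof.
split=> [/(@eqmodP _ (gen_equiv r))/asboolP //|h].
by apply/(@eqmodP _ (gen_equiv r))/asboolP.
Qed.

Lemma gen_class_repr (T : topologicalType) (r : T -> T -> Prop)
    (q : gen_quotient r) :
  gen_class r (repr q) = q.
Proof. exact: reprK. Qed.

Lemma clos_map (T T' : Type) (r : T -> T -> Prop) (r' : T' -> T' -> Prop)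
    (f : T -> T') :
  (forall x y, r x y -> r' (f x) (f y)) ->
  forall x y, clos_refl_sym_trans T r x y ->
    clos_refl_sym_trans T' r' (f x) (f y).
Proof.
move=> hf x y; elim=> {x y} [x y /hf|x|x y _|x y z _ h1 _ h2].
- exact: rst_step.
- exact: rst_refl.
- exact: rst_sym.
- exact: rst_trans h1 h2.
Qed.

(** * Smooth manifolds with boundary *)

Section Manifolds.
Variable R : realType.

(** Differentiability of all iterated directional derivatives on an open set is
    the usual C^oo condition. *)
Definition smooth_on (n m : nat) (O : set 'rV[R]_n) (g : 'rV[R]_n -> 'rV[R]_m)
    : Prop :=
  forall (vs : seq 'rV[R]_n) (x : 'rV[R]_n), O x ->
    differentiable (foldr (fun v h => 'D_v h) g vs) x.

Definition half_space (n : nat) : set 'rV[R]_n :=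
  [set x | forall i : 'I_n, val i = 0%N -> 0 <= x ord0 i].
Arguments half_space n : clear implicits.

(** Smooth maps g between Euclidean spaces with c' = g o c near p on A; when c
    is a boundary chart, g is a local smooth extension of c' o c^-1 beyond the
    half-space. *)
Definition local_rep (T : topologicalType) (n m : nat) (A : set T)
    (c : T -> 'rV[R]_n) (c' : T -> 'rV[R]_m) (p : T)
    : set ('rV[R]_n -> 'rV[R]_m) :=
  [set g | exists O : set 'rV[R]_n,
     [/\ open O, O (c p), smooth_on O g &
         \forall x \near within A (nbhs p), c' x = g (c x)]].

Definition smooth_rel (T : topologicalType) (n m : nat) (A : set T)
    (c : T -> 'rV[R]_n) (c' : T -> 'rV[R]_m) (p : T) : Prop :=
  local_rep A c c' p !=set0.

(** The differential at p of c', in the coordinates c; it does not depend on the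
    chosen representative, as the image of a chart near c p has interior points
    accumulating at c p. *)
Definition coord_diff (T : topologicalType) (n m : nat)
    (c : T -> 'rV[R]_n) (c' : T -> 'rV[R]_m) (p : T)
    : 'Hom('rV[R]_n, 'rV[R]_m) :=
  linfun ('d (xget (fun=> 0) (local_rep setT c c' p)) (c p)).

Record mchart (T : topologicalType) (n : nat) := MChart {
  mc_dom : set T;
  mc_map : T -> 'rV[R]_n  (* relevant on [mc_dom] only *)
}.

Definition mchart_axiom (T : topologicalType) (n : nat) (c : mchart T n)
    : Prop :=
  open (mc_dom c) /\
  exists2 V : set 'rV[R]_n, open V &
    homeo_onto (mc_dom c) V (mc_map c) \/
    homeo_onto (mc_dom c) (V `&` half_space n) (mc_map c).

Record manifold := Manifold {
  carrier :> topologicalType;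
  mdim : nat;
  matlas : set (mchart carrier mdim);
  manifold_hausdorff : hausdorff_space carrier;
  manifold_second_countable : @second_countable carrier;
  matlas_chart : forall c, matlas c -> mchart_axiom c;
  matlas_cover : forall p, exists2 c, matlas c & mc_dom c p;
  matlas_compatible : forall c c', matlas c -> matlas c' ->
    forall p, mc_dom c p -> mc_dom c' p ->
      smooth_rel setT (mc_map c) (mc_map c') p
}.

Definition chart_at (M : manifold) (p : M) : set (mchart M (mdim M)) :=
  [set c | matlas c /\ mc_dom c p].

Definition boundary (M : manifold) : set M :=
  [set p | exists2 c, chart_at p c &
     ~ nbhs (mc_map c p) (mc_map c @` mc_dom c)].
Arguments boundary M : clear implicits.

Definition boundaryless (M : manifold) : Prop := boundary M = set0.

Definition smooth_at (M N : manifold) (f : M -> N) (p : M) : Prop :=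
  {for p, continuous f} /\
  forall c c', chart_at p c -> chart_at (f p) c' ->
    smooth_rel setT (mc_map c) (mc_map c' \o f) p.

Definition smooth_embedding (M N : manifold) (D : set M) (f : M -> N) : Prop :=
  [/\ forall p, D p -> smooth_at f p,
      forall p, D p -> forall c c', chart_at p c -> chart_at (f p) c' ->
        lker (coord_diff (mc_map c) (mc_map c' \o f) p) = 0%VS &
      homeo_onto D (f @` D) f].

(** The standard topology of a finite-dimensional real vector space, transported
    from row vectors by the linear coordinate isomorphism [v2r]. *)
Definition vtop (E : vectType R) : topologicalType :=
  initial_topology (v2r : E -> 'rV[R]_(dim E)).

Definition smooth_section (M : manifold) (E : vectType R) (s : M -> E) : Prop :=
  forall p c, chart_at p c -> smooth_rel setT (mc_map c) (v2r \o s) p.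

Definition section_diff (M : manifold) (E : vectType R)
    (c : mchart M (mdim M)) (s : M -> E) (p : M) : 'Hom('rV[R]_(mdim M), E) :=
  (linfun r2v \o coord_diff (mc_map c) (v2r \o s) p)%VF.

Definition direct_sum (E : vectType R) (V W : {vspace E}) : Prop :=
  directv (V + W) /\ (V + W)%VS = fullv.

(** [0, e) for a = 0 (false) and (1 - e, 1] for a = 1 (true). *)
Definition collar_itv (a : bool) (e : R) : set R :=
  if a then `]1 - e, 1]%classic else `[0, e[%classic.

Definition collar_image (T T' : Type) (iota : R -> T -> T') (a : bool) (e : R)
    (S : set T) : set T' :=
  [set iota t x | t in collar_itv a e & x in S].

Definition prod_chart (T : Type) (n : nat) (c : T -> 'rV[R]_n) (p : R * T)
    : 'rV[R]_(1 + n) :=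
  row_mx (const_mx p.1) (c p.2).

(** [iota] is a diffeomorphism from the product of [collar_itv a e] with N onto
    an open subset of M. *)
Definition collar_diffeo (N M : manifold) (iota : R -> N -> M) (a : bool) (e : R)
    : Prop :=
  let A := collar_itv a e `*` [set: N] in
  let f := fun p : R * N => iota p.1 p.2 in
  [/\ homeo_onto A (f @` A) f, open (f @` A) &
      forall p, A p -> forall c c', chart_at p.2 c -> chart_at (f p) c' ->
        smooth_rel A (prod_chart (mc_map c)) (mc_map c' \o f) p /\
        smooth_rel A (mc_map c' \o f) (prod_chart (mc_map c)) p].

(** * Kuranishi charts and coordinate changes *)

Record chart (X : Type) := Chart {
  cU : manifold;
  cE : vectType R;
  cs : cU -> cE;
  cpsi : cU -> X  (* relevant on the zero set of [cs] only *)
}.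
Arguments cs {X} c u.
Arguments cpsi {X} c u.

Definition zero_set (X : Type) (K : chart X) : set (cU K) :=
  [set u | cs K u = 0].
Arguments zero_set {X} K.

Definition footprint (X : Type) (K : chart X) : set X :=
  cpsi K @` zero_set K.
Arguments footprint {X} K.

Definition chart_core (X : topologicalType) (K : chart X) : Prop :=
  smooth_section (cs K) /\
  homeo_onto (zero_set K) (footprint K) (cpsi K).

(** Charts for the subspace S of X. *)
Definition is_chart (X : topologicalType) (S : set X) (K : chart X) : Prop :=
  [/\ chart_core K, boundaryless (cU K), footprint K !=set0 &
      exists2 O : set X, open O & footprint K = S `&` O].

Definition chart_dim (X : Type) (K : chart X) : int :=
  (mdim (cU K))%:Z - (dim (cE K))%:Z.

Definition index_condition (X : Type) (K K' : chart X)
    (D : set (cU K)) (phi : cU K -> cU K') (phihat : 'Hom(cE K, cE K')) : Prop :=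
  forall u, D u -> forall c c', chart_at u c -> chart_at (phi u) c' ->
    let dphi := coord_diff (mc_map c) (mc_map c' \o phi) u in
    let ds := section_diff c (cs K) u in
    let ds' := section_diff c' (cs K') (phi u) in
    (dphi @: lker ds)%VS = lker ds' /\
    forall C : {vspace cE K},
      direct_sum (limg ds) C -> direct_sum (limg ds') (phihat @: C)%VS.

Definition coordinate_change (X : topologicalType) (K K' : chart X)
    (D : set (cU K)) (phi : cU K -> cU K') (phihat : 'Hom(cE K, cE K')) : Prop :=
  [/\ footprint K `&` footprint K' !=set0,
      open D /\
        D `&` zero_set K =
        zero_set K `&` cpsi K @^-1` (footprint K `&` footprint K'),
      smooth_embedding D phi /\ lker phihat = 0%VS,
      (forall u, D u -> cs K' (phi u) = phihat (cs K u)) /\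
        (forall u, D u -> zero_set K u -> cpsi K' (phi u) = cpsi K u) &
      index_condition D phi phihat].

(** * Kuranishi atlases *)

Definition inter_footprint (X : Type) (N : nat) (F : 'I_N -> set X)
    (I : {set 'I_N}) : set X :=
  [set x | forall i, i \in I -> F i x].

Definition index_set (X : Type) (N : nat) (F : 'I_N -> set X) : choiceType :=
  {I : {set 'I_N} |
    (I != finset.set0) && `[< inter_footprint F I !=set0 >]}.

(** The raw data common to atlases and cobordisms.  The basic footprints are
    [kF]; the basic charts are the [kK] of singletons.  [kdom I J], [kphi I J]
    and [khat I J] are relevant only if I is contained in J, and [kphi I J] only
    on [kdom I J]. *)
Record kdata (X : Type) := KData {
  kN : nat;
  kF : 'I_kN -> set X;
  kF_nonempty : forall i, kF i !=set0;
  kK : index_set kF -> chart X;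
  kdom : forall I J : index_set kF, set (cU (kK I));
  kphi : forall I J : index_set kF, cU (kK I) -> cU (kK J);
  khat : forall I J : index_set kF, 'Hom(cE (kK I), cE (kK J))
}.
Arguments kF {X} k i.
Arguments kdom {X k} I J.
Arguments kphi {X k} I J x.
Arguments khat {X k} I J.

Definition kidx (X : Type) (K : kdata X) : choiceType := index_set (kF K).

Definition kU (X : Type) (K : kdata X) (I : kidx K) : manifold := cU (kK I).
Definition kE (X : Type) (K : kdata X) (I : kidx K) : vectType R := cE (kK I).

Definition isub (X : Type) (K : kdata X) (I J : kidx K) : bool :=
  val I \subset val J.
Definition ipsub (X : Type) (K : kdata X) (I J : kidx K) : bool :=
  val I \proper val J.

Lemma singleton_index (X : Type) (K : kdata X) (i : 'I_(kN K)) :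
  ([set i]%SET != finset.set0) &&
  `[< inter_footprint (kF K) [set i]%SET !=set0 >].
Proof.
apply/andP; split; first by apply/set0Pn; exists i; rewrite finset.inE.
apply/asboolP; have [x Fx] := kF_nonempty i; exists x => j.
by rewrite finset.inE => /eqP ->.
Qed.

Definition isingle (X : Type) (K : kdata X) (i : 'I_(kN K)) : kidx K :=
  exist _ [set i]%SET (singleton_index i).

Definition atlas_core (X : topologicalType) (d : int) (K : kdata X) : Prop :=
  [/\ \bigcup_i kF K i = setT,
      forall I : kidx K,
        footprint (kK I) = inter_footprint (kF K) (val I) /\
        chart_dim (kK I) = d,
      forall I : kidx K,
        [/\ kdom I I = setT, forall x, kphi I I x = x & khat I I = \1%VF] &
      forall I J L : kidx K, ipsub I J -> ipsub J L ->
        [/\ (khat J L \o khat I J)%VF = khat I L,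
            kdom I J `&` kphi I J @^-1` kdom J L `<=` kdom I L &
            forall x, kdom I J x -> kdom J L (kphi I J x) ->
              kphi J L (kphi I J x) = kphi I L x]].

Definition kuranishi_atlas (X : topologicalType) (d : int) (K : kdata X) : Prop :=
  [/\ compact [set: X] /\ metrizable R X,
      atlas_core d K,
      forall I : kidx K, is_chart setT (kK I) &
      forall I J : kidx K, ipsub I J ->
        coordinate_change (kdom I J) (kphi I J) (khat I J)].

Definition additive_atlas (X : Type) (K : kdata X) : Prop :=
  forall I : kidx K,
    bijective (fun e : forall i : {i : 'I_(kN K) | i \in val I},
                         kE (isingle (val i)) =>
      \sum_(i : {i : 'I_(kN K) | i \in val I})
        khat (isingle (val i)) I (e i) : kE I).

(** U_IH for a set H which need not be an index: empty in the latter case. *)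
Definition kdom_ext (X : Type) (K : kdata X) (I : kidx K)
    (H : {set 'I_(kN K)}) : set (kU I) :=
  [set x | exists2 H' : kidx K, val H' = H & kdom I H' x].
Arguments kdom_ext {X K} I H.

Definition tame (X : Type) (K : kdata X) : Prop :=
  [/\ additive_atlas K,
      forall I J L : kidx K, isub I J -> isub I L ->
        kdom I J `&` kdom I L = kdom_ext I (val J :|: val L)%SET &
      forall I J L : kidx K, isub I J -> isub J L ->
        kphi I J @` kdom I L =
        kdom J L `&` [set y | cs (kK J) y \in limg (khat I J)]].

(** * Kuranishi cobordisms *)

Record collar (Y : Type) := Collar {
  yBd : bool -> set Y;
  yWidth : R;
  yIota : bool -> R -> Y -> Y  (* [yIota a] is relevant on A^a x [yBd a] only *)
}.

Definition collared_cobordism (Y : topologicalType) (C : collar Y) : Prop :=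
  [/\ [/\ separable Y, locally_compact [set: Y] & metrizable R Y],
      (forall a, closed (yBd C a)) /\ yBd C false `&` yBd C true = set0,
      0 < yWidth C /\
        (forall a y, yBd C a y -> yIota C a a%:R y = y),
      forall a,
        let A := collar_itv a (yWidth C) `*` yBd C a in
        let f := fun p : R * Y => yIota C a p.1 p.2 in
        homeo_onto A (f @` A) f /\ open (f @` A) &
      collar_image (yIota C false) false (yWidth C) (yBd C false) `&`
      collar_image (yIota C true) true (yWidth C) (yBd C true) = set0].

Definition collared (Y : Type) (C : collar Y) (F : set Y) : Prop :=
  forall a,
    (exists d, [/\ 0 < d, d <= yWidth C &
       F `&` collar_image (yIota C a) a d (yBd C a) =
       collar_image (yIota C a) a d (F `&` yBd C a)]) /\
    (F `&` yBd C a = set0 ->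
       F `&` collar_image (yIota C a) a (yWidth C) (yBd C a) = set0).

(** Boundary data of a chart K: the manifolds, sections and footprint maps of
    its boundary charts, and collars.  The boundary part [bU a] is a manifold in
    its own right, included in the domain of K by [bIota a a%:R]. *)
Record bdata (Y : Type) (K : chart Y) := BData {
  bU : bool -> manifold;
  bs : forall a, bU a -> cE K;
  bpsi : forall a, bU a -> Y;
  bWidth : R;
  bIota : forall a, R -> bU a -> cU K
}.
Arguments bs {Y K} b a x.
Arguments bpsi {Y K} b a x.
Arguments bIota {Y K} b a t x.

Definition bchart (Y : Type) (K : chart Y) (B : bdata K) (a : bool) : chart Y :=
  Chart (bs B a) (bpsi B a).

Definition collared_chart (Y : topologicalType) (C : collar Y) (K : chart Y)
    (B : bdata K) : Prop :=
  [/\ [/\ chart_core K, open (footprint K), collared C (footprint K) &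
          exists a, footprint K `&` yBd C a !=set0],
      [/\ 0 < bWidth B,
          forall a, collar_diffeo (bIota B a) a (bWidth B),
          boundary (cU K) =
            range (bIota B false 0) `|` range (bIota B true 1) &
          range (bIota B false 0) `&` range (bIota B true 1) = set0],
      forall a, [set: bU B a] !=set0 <-> footprint K `&` yBd C a !=set0,
      forall a, footprint K `&` yBd C a !=set0 ->
        is_chart (yBd C a) (bchart B a) /\
        footprint (bchart B a) = footprint K `&` yBd C a &
      forall a, exists d, [/\ 0 < d, d <= bWidth B, d <= yWidth C &
        forall t x, collar_itv a d t ->
          cs K (bIota B a t x) = bs B a x /\
          (bs B a x = 0 ->
             cpsi K (bIota B a t x) = yIota C a t (bpsi B a x))]].

Definition bdom (Y : Type) (K : chart Y) (B : bdata K) (D : set (cU K))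
    (a : bool) : set (bU B a) :=
  [set x | D (bIota B a a%:R x)].
Arguments bdom {Y K} B D a.

Definition collared_change (Y : topologicalType) (C : collar Y)
    (K K' : chart Y) (B : bdata K) (B' : bdata K')
    (D : set (cU K)) (phi : cU K -> cU K') (phihat : 'Hom(cE K, cE K')) : Prop :=
  forall a,
    [/\ exists d, [/\ 0 < d, d <= bWidth B &
          D `&` collar_image (bIota B a) a d setT =
          collar_image (bIota B a) a d (bdom B D a)],
        footprint K' `&` yBd C a !=set0 ->
        exists bphi : bU B a -> bU B' a,
          @coordinate_change Y (bchart B a) (bchart B' a)
            (bdom B D a) bphi phihat /\
          exists d, [/\ 0 < d, d <= bWidth B /\ d <= bWidth B',
            D `&` collar_image (bIota B a) a d setT =
            collar_image (bIota B a) a d (bdom B D a),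
            phi @` D `&` collar_image (bIota B' a) a d setT =
            collar_image (bIota B' a) a d (bphi @` bdom B D a) &
            forall t x, collar_itv a d t -> bdom B D a x ->
              phi (bIota B a t x) = bIota B' a t (bphi x)] &
        footprint K' `&` yBd C a = set0 ->
        exists d, [/\ 0 < d, d <= bWidth B &
          D `&` collar_image (bIota B a) a d setT = set0]].

(** The boundary data [B I] are relevant only if [kK I] has collared boundary. *)
Definition kuranishi_cobordism_on (Y : topologicalType) (C : collar Y)
    (d : int) (K : kdata Y) (B : forall I : kidx K, bdata (kK I)) : Prop :=
  [/\ compact [set: Y] /\ collared_cobordism C,
      atlas_core d K,
      forall I : kidx K,
        collared_chart C (B I) \/
        [/\ is_chart setT (kK I), compact (closure (footprint (kK I))) &
            closure (footprint (kK I)) `<=` ~` (yBd C false `|` yBd C true)],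
      forall I J : kidx K, ipsub I J ->
        coordinate_change (kdom I J) (kphi I J) (khat I J) &
      forall I J : kidx K, ipsub I J ->
        (exists a, footprint (kK I) `&` yBd C a !=set0) ->
        collared_change C (B I) (B J)
          (kdom I J) (kphi I J) (khat I J)].

Definition kuranishi_cobordism (Y : topologicalType) (d : int) (K : kdata Y)
    : Prop :=
  exists (C : collar Y) (B : forall I : kidx K, bdata (kK I)),
    kuranishi_cobordism_on C d B.

(** * Realizations *)

Section Realization.
Variables (X : Type) (K : kdata X).

Definition dom_union : topologicalType := {I : kidx K & (kU I : topologicalType)}.

Definition bundle_dom (I : kidx K) : topologicalType :=
  (kU I * vtop (kE I))%type.

Definition bundle_union : topologicalType := {I : kidx K & bundle_dom I}.

Inductive dom_step : dom_union -> dom_union -> Prop :=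
| DomStep (I J : kidx K) (x : kU I) : isub I J -> kdom I J x ->
    dom_step (existT _ I x) (existT _ J (kphi I J x)).

Inductive bundle_step : bundle_union -> bundle_union -> Prop :=
| BundleStep (I J : kidx K) (x : kU I) (e : kE I) : isub I J -> kdom I J x ->
    bundle_step (existT bundle_dom I (x, e))
                (existT bundle_dom J (kphi I J x, khat I J e)).

Definition realization : topologicalType := gen_quotient dom_step.
Definition bundle_realization : topologicalType := gen_quotient bundle_step.

Definition pi_K (I : kidx K) (x : kU I) : realization :=
  gen_class dom_step (existT _ I x).

Definition pi_E (I : kidx K) (xe : bundle_dom I) : bundle_realization :=
  gen_class bundle_step (existT bundle_dom I xe).

Definition bundle_pr (z : bundle_union) : dom_union :=
  existT _ (projT1 z) (projT2 z).1.

Definition pr_K (q : bundle_realization) : realization :=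
  gen_class dom_step (bundle_pr (repr q)).

Lemma pr_pi_E (I : kidx K) (x : kU I) (e : kE I) : pr_K (pi_E (x, e)) = pi_K x.
Proof.
apply/gen_classP.
have /gen_classP := gen_class_repr (pi_E ((x, e) : bundle_dom I)).
apply: (@clos_map _ _ bundle_step dom_step bundle_pr).
by move=> _ _ [I' J x' e' sIJ dx]; exact: (DomStep sIJ dx).
Qed.

Definition fibre (p : realization) : Type := {q : bundle_realization | pr_K q = p}.

Definition fibre_map (I : kidx K) (x : kU I) (e : kE I) : fibre (pi_K x) :=
  exist _ (pi_E ((x, e) : bundle_dom I)) (pr_pi_E x e).

End Realization.

(** Operations and laws are separated so that equality of vector space
    structures is equality of their operations. *)
Record vect_ops (T : Type) := VectOps {
  vzero : T;
  vadd : T -> T -> T;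
  vopp : T -> T;
  vscale : R -> T -> T
}.

Definition is_vector_space (T : Type) (V : vect_ops T) : Prop :=
  [/\ [/\ associative (vadd V), commutative (vadd V),
          left_id (vzero V) (vadd V) &
          left_inverse (vzero V) (vopp V) (vadd V)],
      forall x, vscale V 1 x = x,
      forall a b x, vscale V a (vscale V b x) = vscale V (a * b) x,
      forall a x y,
        vscale V a (vadd V x y) = vadd V (vscale V a x) (vscale V a y) &
      forall a b x,
        vscale V (a + b) x = vadd V (vscale V a x) (vscale V b x)].

Definition linear_to (E : vectType R) (T : Type) (V : vect_ops T) (f : E -> T)
    : Prop :=
  (forall e e', f (e + e') = vadd V (f e) (f e')) /\
  (forall a e, f (a *: e) = vscale V a (f e)).

End Manifolds.

Arguments half_space R n : clear implicits.
Arguments boundary {R} M.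
Arguments cs {R X} c u.
Arguments cpsi {R X} c u.
Arguments zero_set {R X} K.
Arguments footprint {R X} K.
Arguments kF {R X} k i.
Arguments kdom {R X k} I J.
Arguments kphi {R X k} I J x.
Arguments khat {R X k} I J.
Arguments kdom_ext {R X K} I H.
Arguments bs {R Y K} b a x.
Arguments bpsi {R Y K} b a x.
Arguments bIota {R Y K} b a t x.
Arguments bdom {R Y K} B D a.
Arguments pi_K {R X K} I x.
Arguments pi_E {R X K} I xe.
Arguments fibre_map {R X K} I x e.

(* Main.v *)
Require Import Defs.
From mathcomp Require Import all_boot all_order all_algebra.
From mathcomp Require Import all_classical all_reals all_analysis.
From Stdlib Require Import Relations.

(** Adjoin the empty set to the indices, with domain X and with the inverse
    footprint maps as coordinate changes.  Tameness then says that two points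
    of the domains are identified iff they have a common image in U_(I u J), iff
    they have a common preimage in U_(I n J), and that the coordinate changes
    have closed images.  Hence an open set O of U_I extends to a saturated open
    set: remove from each U_J the closed image of the points of U_(I n J) which
    do not lie over O.  Distinct classes are separated by a continuous function
    on the realization: give the values 1 and 0 to their representatives of
    minimal index, and extend by Tietze's theorem from the images of smaller
    strata to each U_J, by induction on |J|.  All this is carried out for the
    bundle and transferred to |K| along the zero section.  The fibre over p is
    E_L for the largest L such that p is in the image of U_L. *)

Set Implicit Arguments.
Unset Strict Implicit.
Unset Printing Implicit Defensive.

Import Order.TTheory GRing.Theory Num.Theory.
Import numFieldNormedType.Exports.
Import VectorInternalTheory.

Local Open Scope classical_set_scope.
Local Open Scope ring_scope.

(** * Separation and quotients *)

Section NormalSpaces.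
Variable T : topologicalType.

Lemma closure_disjoint (A O : set T) :
  open O -> A `&` O = set0 -> closure A `&` O = set0.
Proof.
move=> oO AO; apply/disjoints_subset.
have /closure_id -> : closed (~` O) by exact: open_closedC.
exact/closureS/disjoints_subset.
Qed.

(** By regularity each point of [K] has a neighbourhood missing the closure of every small open [W]
    containing [B]. Compactness, in its near-covering form, makes one [W] serve all of [K], and [P]
    is the complement of its closure. *)
Lemma regular_compact_separation (K B : set T) :
  regular_space T -> compact K -> closed B -> K `&` B = set0 ->
  exists P, [/\ open P, K `<=` P & closure P `&` B = set0].
Proof.
move=> regT cK clB KB.
(* Near [F] means for every sufficiently small open set containing [B]. *)
pose F : set_system (set T) := [set S | exists W0, [/\ open W0, B `<=` W0 &
  forall W, open W -> B `<=` W -> W `<=` W0 -> S W]].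
have FF : Filter F.
  split.
  - by exists setT; split=> //; exact: openT.
  - move=> S1 S2 [W1 [oW1 BW1 h1]] [W2 [oW2 BW2 h2]].
    exists (W1 `&` W2); split; [exact: openI|by move=> x Bx; split; auto|].
    by move=> W oW BW WW; split; [apply: h1|apply: h2] => // x /WW [].
  - move=> S1 S2 S12 [W1 [oW1 BW1 h1]]; exists W1; split=> // W oW BW WW.
    exact/S12/h1.
have := (compact_near_coveringP K).1 cK _ F (fun W x => ~ closure W x) FF.
case=> [x Kx|W0 [oW0 BW0]].
  have nBx : ~ B x by move=> Bx; have : set0 x by rewrite -KB.
  have [U [V [oU oV Ux BV UV]]] :=
    (regular_openP x).1 (regT x) _ clB nBx.
  exists (U, [set W | open W /\ B `<=` W /\ W `<=` V]) => /=.
    split; first exact: open_nbhs_nbhs.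
    by exists V; split.
  move=> [y W] [/= Uy [oW [BW WV]]] cWy.
  have WU : W `&` U = set0.
    by apply/seteqP; split=> // z [/WV Vz Uz]; rewrite -UV.
  by have := closure_disjoint oU WU; rewrite -subset0 => /(_ y); apply.
move=> /(_ W0 oW0 BW0 (fun _ => id)) KW0.
exists (~` closure W0); split=> //.
  exact/closed_openC/closed_closure.
rewrite setIC; apply/disjoints_subset => x Bx.
rewrite closure_setC; apply; rewrite /interior.
by apply: filterS (@subset_closure _ W0) _; exact/open_nbhs_nbhs/(conj oW0)/BW0.
Qed.

(** The sets [P n] cover A with closures missing B, and the [Q n] cover B with closures missing A.
    Removing from the n-th set of one family the closures of the first n+1 sets of the other makes
    the unions disjoint: at a common point, the set of smaller index has been removed from the
    other. *)
Lemma regular_sigma_compact_normal (R : realType) (C : nat -> set T) :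
  regular_space T -> (forall n, compact (C n)) -> \bigcup_n C n = setT ->
  normal_space T.
Proof.
move=> regT cC CT; apply/(@normal_openP R) => A B clA clB AB.
have sep (A' B' : set T) : closed A' -> closed B' -> A' `&` B' = set0 ->
    forall n, exists P, [/\ open P, C n `&` A' `<=` P & closure P `&` B' = set0].
  move=> clA' clB' AB' n; apply: regular_compact_separation => //.
    exact: compact_closedI.
  by rewrite -setIA AB' setI0.
have [P hP] := choice (sep _ _ clA clB AB).
have [Q hQ] := choice (sep _ _ clB clA (etrans (setIC _ _) AB)).
pose less (S : nat -> set T) n := ~` \bigcup_(k in `I_n.+1) closure (S k).
have oless S n : open (less S n).
  apply/closed_openC/closed_bigcup => // *; exact: closed_closure.
exists (\bigcup_n (P n `&` less Q n)), (\bigcup_n (Q n `&` less P n)); split.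
- by apply: bigcup_open => n _; apply: openI => //; have [] := hP n.
- by apply: bigcup_open => n _; apply: openI => //; have [] := hQ n.
- move=> x Ax; have [n _ Cx] : (\bigcup_n C n) x by rewrite CT.
  exists n => //; split; first by have [_ + _] := hP n; apply.
  case=> k _ cx; have [_ _] := hQ k.
  by rewrite -subset0 => /(_ x); apply.
- move=> x Bx; have [n _ Cx] : (\bigcup_n C n) x by rewrite CT.
  exists n => //; split; first by have [_ + _] := hQ n; apply.
  case=> k _ cx; have [_ _] := hP k.
  by rewrite -subset0 => /(_ x); apply.
apply/seteqP; split=> // x [[n _ [Px nQ]] [m _ [Qx nP]]].
have [nm|mn] := leqP n m.
- by apply: nP; exists n => //=; exact: subset_closure.
- by apply: nQ; exists m => //=; [rewrite ltnS ltnW|exact: subset_closure].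
Qed.

Lemma locally_compact_regular :
  hausdorff_space T ->
  (forall x : T, exists2 C, compact C & nbhs x C) -> regular_space T.
Proof. by move=> hT lc x; have [C cC xC] := lc x; exact: compact_regular cC xC. Qed.

(** Basic open sets with compact closure cover [T], since each point has one inside a compact, hence
    closed, neighbourhood. *)
Lemma second_countable_sigma_compact :
  hausdorff_space T ->
  (forall x : T, exists2 C, compact C & nbhs x C) -> @second_countable T ->
  exists2 C : nat -> set T, (forall n, compact (C n)) & \bigcup_n C n = setT.
Proof.
move=> hT lc [B cB [Bo bB]].
have [B0|Bn] := pselect (B = set0).
  exists (fun=> set0) => [_|]; first exact: compact0.
  apply/seteqP; split=> // x _; have [U] := bB x setT filterT.
  by rewrite B0 => -[[]].
have [f fB] : exists f : nat -> set T, forall U, B U -> exists n, f n = U.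
  have /pfcard_geP[B0|/unsquash f] := cB; first by rewrite B0 in Bn.
  exists f => U BU; have [n _ <-] := 'surj_f BU; by exists n.
exists (fun n => if `[< compact (closure (f n)) >] then closure (f n) else set0).
  by move=> n; case: asboolP => // _; exact: compact0.
apply/seteqP; split=> // x _; have [C cC xC] := lc x.
have [U [BU Ux] UC] := bB x C xC; have [n fn] := fB U BU.
exists n => //; rewrite fn; case: asboolP => [_|[]]; first exact: subset_closure.
apply: (subclosed_compact (@closed_closure _ U) cC).
have /closure_id -> : closed C by exact: compact_closed.
exact: closureS.
Qed.

End NormalSpaces.

Lemma continuous_separation_hausdorff (R : realType) (T : topologicalType) :
  (forall x y : T, x <> y ->
     exists2 f : T -> R, continuous f & f x <> f y) ->
  hausdorff_space T.
Proof.
move=> sep; rewrite open_hausdorff => x y /eqP /sep[f cf /eqP fxy].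
have := @Rhausdorff R; rewrite open_hausdorff => /(_ _ _ fxy).
case=> -[A B] /= [Ax By] [oA oB /eqP AB].
exists (f @^-1` A, f @^-1` B).
  by move: Ax By; rewrite !inE.
move/continuousP: cf => cf.
split; [exact: cf|exact: cf|apply/eqP].
by rewrite -preimage_setI AB preimage_set0.
Qed.

Lemma hausdorff_prod (S T : topologicalType) :
  hausdorff_space S -> hausdorff_space T -> hausdorff_space (S * T)%type.
Proof.
move=> hS hT [x1 x2] [y1 y2] h; congr pair.
  apply: hS => A B Ax By.
  have [||z [[Az _] [Bz _]]] := h (A `*` setT) (B `*` setT).
  - by exists (A, setT) => //; split=> //; exact: filterT.
  - by exists (B, setT) => //; split=> //; exact: filterT.
  by exists z.1.
apply: hT => A B Ax By.
have [||z [[_ Az] [_ Bz]]] := h (setT `*` A) (setT `*` B).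
- by exists (setT, A) => //; split=> //; exact: filterT.
- by exists (setT, B) => //; split=> //; exact: filterT.
by exists z.2.
Qed.

Lemma metrizable_hausdorff (R : realType) (T : topologicalType) :
  metrizable R T -> hausdorff_space T.
Proof.
case=> d [d0 ds dt dn]; rewrite open_hausdorff => x y /eqP xy.
(* Positivity is not among the clauses of [metrizable]; it comes from the triangle inequality for u,
   v, u. *)
have dge0 u v : 0 <= d u v.
  have := dt u v u; rewrite (ds v u) (d0 u u).2// -mulr2n.
  by rewrite pmulrn_lge0.
have dxy : 0 < d x y.
  rewrite lt_neqAle dge0 andbT eq_sym; apply/eqP => e.
  exact/xy/d0.
pose P z := (fun w => d z w < d x y / 2)°.
exists (P x, P y); first (split; rewrite inE).
- by rewrite /P/= /interior/= dn; exists (d x y / 2) => //=; rewrite divr_gt0.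
- by rewrite /P/= /interior/= dn; exists (d x y / 2) => //=; rewrite divr_gt0.
split; [exact: open_interior|exact: open_interior|].
apply/eqP/seteqP; split=> // z [/interior_subset /= xz /interior_subset /= yz].
have := dt x z y; rewrite leNgt => /negP; apply.
by rewrite (splitr (d x y)) ltrD// ds.
Qed.

(** This lets invariant functions be pushed to the quotient by evaluating them on the chosen
    representatives [repr]. *)
Lemma gen_quotient_elim (T : topologicalType) (r : T -> T -> Prop) (Z : Type)
    (g : T -> Z) :
  (forall x y, r x y -> g x = g y) -> forall x, g (repr (gen_class r x)) = g x.
Proof.
move=> gr x; have gE y z : clos_refl_sym_trans T r y z -> g y = g z.
  by elim=> {y z} [y z /gr|//|y z _ ->|y z w _ -> _ ->].
exact/gE/gen_classP/gen_class_repr.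
Qed.

Lemma gen_quotient_continuous (T Z : topologicalType) (r : T -> T -> Prop)
    (g : T -> Z) :
  continuous g -> (forall x y, r x y -> g x = g y) ->
  continuous (fun q : gen_quotient r => g (repr q)).
Proof.
move=> cg gr; apply/quotient_continuous.
rewrite (_ : _ \o _ = g)//; apply/funext => x /=.
exact: (gen_quotient_elim gr).
Qed.

Lemma gen_quotient_open (T : topologicalType) (r : T -> T -> Prop) (W : set T) :
  open W -> (forall x y, r x y -> W x <-> W y) ->
  open [set q : gen_quotient r | W (repr q)] /\
  forall x, W (repr (gen_class r x)) <-> W x.
Proof.
move=> oW Wr; have WE x : W (repr (gen_class r x)) = W x.
  by apply: gen_quotient_elim => y z /Wr/propext.
split=> [|x]; last by rewrite WE.
rewrite /open /= /quotient_open (_ : _ @^-1` _ = W)//.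
by apply/seteqP; split=> x; rewrite /preimage/= WE.
Qed.

(** * Systems glued along closed embeddings *)

(** Strata are ordered by inclusion of their supports, and [D i j], [phi i j] matter only for i
    below j. The decisive fields are [gluing_closed] (closed images), [gluing_inter] (points with a
    common image have a common preimage) and [gluing_union] (two images of a point have a common
    further image). *)
Record gluing (N : nat) (T : choiceType) (supp : T -> {set 'I_N})
    (meet : T -> T -> T) (V : T -> topologicalType)
    (D : forall i j : T, set (V i)) (phi : forall i j : T, V i -> V j) : Prop := {
  gluing_supp_inj : injective supp;
  gluing_meet : forall i j, supp (meet i j) = (supp i :&: supp j)%SET;
  gluing_dom_id : forall i x, D i i x;
  gluing_phi_id : forall i x, phi i i x = x;
  gluing_dom_le : forall i j l x, supp i \subset supp j ->
    supp j \subset supp l -> D i l x -> D i j x;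
  gluing_dom : forall i j l x, supp i \subset supp j ->
    supp j \subset supp l -> D i j x -> (D j l (phi i j x) <-> D i l x);
  gluing_comp : forall i j l x, supp i \subset supp j ->
    supp j \subset supp l -> D i l x -> phi j l (phi i j x) = phi i l x;
  gluing_inj : forall i j x y, supp i \subset supp j -> D i j x -> D i j y ->
    phi i j x = phi i j y -> x = y;
  gluing_open : forall i j O, supp i \subset supp j -> open O ->
    open (D i j `&` phi i j @^-1` O);
  gluing_closed : forall i j C, supp i \subset supp j -> closed C ->
    closed (phi i j @` (D i j `&` C));
  gluing_inter : forall i j l x y, supp i \subset supp l ->
    supp j \subset supp l -> D i l x -> D j l y -> phi i l x = phi j l y ->
    exists w, [/\ D (meet i j) l w, phi (meet i j) i w = x &
                  phi (meet i j) j w = y];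
  gluing_union : forall g i j w, supp g \subset supp i ->
    supp g \subset supp j -> D g i w -> D g j w ->
    exists l, [/\ supp i \subset supp l, supp j \subset supp l & D g l w]
}.

Lemma closed_preimage_within_continuous (S : topologicalType) (R : realType)
    (A : set S) (h : S -> R) :
  (forall C : set R, closed C -> closed (A `&` h @^-1` C)) ->
  {within A, continuous h}.
Proof.
move=> hC; apply/continuous_closedP => C clC; apply/closed_subspaceP.
by exists (A `&` h @^-1` C); [exact: hC|rewrite setIAC setIid setIC].
Qed.

Section Gluing.
Variables (N : nat) (T : choiceType) (supp : T -> {set 'I_N}).
Variables (meet : T -> T -> T) (V : T -> topologicalType).
Variables (D : forall i j : T, set (V i)) (phi : forall i j : T, V i -> V j).
Arguments D : clear implicits.
Arguments phi : clear implicits.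
Hypothesis G : gluing supp meet D phi.

Local Notation "i <<= j" := (supp i \subset supp j) (at level 70).

(** One common image replaces the zigzags of the generated equivalence relation. *)
Definition glued (i : T) (x : V i) (j : T) (y : V j) : Prop :=
  exists l, [/\ i <<= l, j <<= l, D i l x, D j l y & phi i l x = phi j l y].

Lemma glued_refl i (x : V i) : glued x x.
Proof. by exists i; split=> //; exact: (gluing_dom_id G). Qed.

Lemma glued_sym i (x : V i) j (y : V j) : glued x y -> glued y x.
Proof. by case=> l [? ? ? ? e]; exists l. Qed.

Lemma glued_phi i j (x : V i) : i <<= j -> D i j x -> glued x (phi i j x).
Proof.
move=> ij Dx; exists j; split=> //; first exact: (gluing_dom_id G).
by rewrite (gluing_phi_id G).
Qed.

(** The two images of [y] have a common further image by [gluing_union], and [x] and [z] both reach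
    it. *)
Lemma glued_trans i (x : V i) j (y : V j) k (z : V k) :
  glued x y -> glued y z -> glued x z.
Proof.
case=> l [il jl Dx Dy xy] [m [jm km Dy' Dz yz]].
have [n [ln mn Dn]] := gluing_union G jl jm Dy Dy'.
have Dln := (gluing_dom G jl ln Dy).2 Dn.
have Dmn := (gluing_dom G jm mn Dy').2 Dn.
have Din : D i n x by apply/(gluing_dom G il ln Dx); rewrite xy.
have Dkn : D k n z by apply/(gluing_dom G km mn Dz); rewrite -yz.
exists n; split=> //; [exact: fintype.subset_trans ln|exact: fintype.subset_trans mn|].
rewrite -(gluing_comp G il ln Din) -(gluing_comp G km mn Dkn) xy -yz.
by rewrite (gluing_comp G jl ln Dn) (gluing_comp G jm mn Dn).
Qed.

Lemma glued_same i (x y : V i) : glued x y -> x = y.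
Proof. by case=> l [il _ Dx Dy]; exact: (gluing_inj G). Qed.

Lemma meet_lel i j : meet i j <<= i.
Proof. by rewrite (gluing_meet G) subsetIl. Qed.

Lemma meet_ler i j : meet i j <<= j.
Proof. by rewrite (gluing_meet G) subsetIr. Qed.

Lemma meet_id i j : i <<= j -> meet j i = i.
Proof.
move=> ij; apply: (gluing_supp_inj G); rewrite (gluing_meet G); exact/finset.setIidPr.
Qed.

(** [W j] is the complement of the image of those points of the stratum [meet i j] that do not map
    into [O]; this image is closed by [gluing_closed]. *)
Lemma glued_open_extension i (O : set (V i)) : open O ->
  exists W : forall j, set (V j), [/\ forall j, open (W j), W i = O &
    forall j l x, j <<= l -> D j l x -> (W l (phi j l x) <-> W j x)].
Proof.
move=> oO; pose m := meet i.
pose O' j := D (m j) i `&` phi (m j) i @^-1` O.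
exists (fun j => ~` (phi (m j) j @` (D (m j) j `&` ~` O' j))).
have WE j z : (~` (phi (m j) j @` (D (m j) j `&` ~` O' j))) z <->
    forall w, D (m j) j w -> phi (m j) j w = z -> O' j w.
  split=> [h w Dw wz|h [w [Dw nO] wz]]; last exact/nO/h.
  by apply: contrapT => nO; apply: h; exists w.
split.
- move=> j; apply/closed_openC/(gluing_closed G); first exact: meet_ler.
  exact/open_closedC/(gluing_open G)/oO/meet_lel.
- apply/seteqP; split=> z; rewrite WE /O' /m (meet_id (subxx _)).
    move=> /(_ z (gluing_dom_id G _) (gluing_phi_id G _)) [_].
    by rewrite /= (gluing_phi_id G).
  move=> Oz w _; rewrite (gluing_phi_id G) => ->.
  by split; rewrite /= ?(gluing_phi_id G)//; exact: (gluing_dom_id G).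
move=> j l z jl Dz; rewrite !WE.
have mjl : m j <<= m l by rewrite !(gluing_meet G) finset.setIS.
have mji := meet_lel i j; have mjj := meet_ler i j.
have mli := meet_lel i l; have mll := meet_ler i l.
split=> h w Dw wz.
(* A point of [V (m j)] over [z] maps on to a point of [V (m l)] over the image of [z]. *)
- have Dwl : D (m j) l w by apply/(gluing_dom G mjj jl Dw); rewrite wz.
  have Dwm := gluing_dom_le G mjl mll Dwl.
  have [||Di Oi] := h (phi (m j) (m l) w).
  + exact/(gluing_dom G).
  + by rewrite (gluing_comp G)// -wz (gluing_comp G).
  have Dwi : D (m j) i w by exact/(gluing_dom G mjl mli Dwm).
  by split=> //; move: Oi; rewrite /= (gluing_comp G).
(* Conversely, a point of [V (m l)] over the image of [z] shares with [z] a preimage in a stratum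
   [g] below both [m l] and [j], hence below [m j]. *)
have [v [Dv vw vz]] := gluing_inter G mll jl Dw Dz wz.
set g := meet (m l) j in v Dv vw vz.
have gj : g <<= j := meet_ler _ _; have gml : g <<= m l := meet_lel _ _.
have gl := fintype.subset_trans gj jl.
have gmj : g <<= m j.
  by rewrite [supp (m j)](gluing_meet G) finset.subsetI gj (fintype.subset_trans gml).
have Dvj := gluing_dom_le G gj jl Dv.
have Dvm := gluing_dom_le G gmj mjj Dvj.
have [||Di Oi] := h (phi g (m j) v).
- exact/(gluing_dom G).
- by rewrite (gluing_comp G).
have gi := fintype.subset_trans gmj mji.
have Dvi : D g i v by exact/(gluing_dom G gmj mji Dvm).
have Dvml := gluing_dom_le G gml mll Dv.
split; first by rewrite -vw; exact/(gluing_dom G).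
by rewrite -vw /= (gluing_comp G)//; move: Oi; rewrite /= (gluing_comp G).
Qed.

(** * Continuous functions with prescribed values on a glued system *)

Section Extension.
Variable R : realType.
Variables (P : forall l : T, set (V l)) (p : forall l : T, V l -> R).
Arguments P : clear implicits.
Arguments p : clear implicits.
Hypothesis normalV : forall l, normal_space (V l).
Hypothesis p_closed : forall (l : T) (C : set R), closed C -> closed (P l `&` p l @^-1` C).
Hypothesis p_bounded : forall (l : T) (z : V l), `|p l z| <= 1.
(** Points of [P] come from no smaller stratum, so the prescribed values cannot conflict with values
    imposed from below. *)
Hypothesis P_fresh : forall j l x, j <<= l -> supp j != supp l -> D j l x ->
  ~ P l (phi j l x).

Let finT : finite_set [set: T].
Proof.
have := @finite_preimage _ _ [set: {set 'I_N}] supp.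
rewrite preimage_setT; apply=> [x y _ _|]; first exact: (gluing_supp_inj G).
exact: finite_finset.
Qed.

Let good (f : forall l : T, V l -> R) l :=
  [/\ continuous (f l), forall z, `|f l z| <= 1,
      forall z, P l z -> f l z = p l z &
      forall j x, j <<= l -> supp j != supp l -> D j l x ->
        f l (phi j l x) = f j x].

(** The values forced on [V l] by [p] and by the smaller strata fit together to a function [h],
    continuous on the closed set [A] where they are given. Tietze's theorem extends it with the
    bound 1, which keeps the induction going. *)
Let extend (f : forall l : T, V l -> R) l :
  (forall j, #|supp j| < #|supp l| -> good f j)%N ->
  exists g : V l -> R,
    [/\ continuous g, forall z, `|g z| <= 1,
        forall z, P l z -> g z = p l z &
        forall j x, j <<= l -> supp j != supp l -> D j l x ->
          g (phi j l x) = f j x].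
Proof.
move=> hf.
have ltl j : j <<= l -> supp j != supp l -> (#|supp j| < #|supp l|)%N.
  by move=> jl ne; apply: proper_card; rewrite finset.properEneq ne.
(* These are the values imposed at [z] from below; [compat] shows that there is at most one. The
   default 0 in [h] occurs only off [A]. *)
pose val_at z := [set r | exists j (x : V j),
  [/\ j <<= l, supp j != supp l, D j l x, phi j l x = z & r = f j x]].
pose h z := if `[< P l z >] then p l z else xget 0 (val_at z).
have compat j x j' x' : j <<= l -> supp j != supp l -> D j l x ->
    j' <<= l -> supp j' != supp l -> D j' l x' ->
    phi j l x = phi j' l x' -> f j x = f j' x'.
  move=> jl nj Dx jl' nj' Dx' e.
  have [w [Dw <- <-]] := gluing_inter G jl jl' Dx Dx' e.
  (* Both values equal the value at the common preimage [w]: either [k] is the meet itself, or [f k]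
     already extends the function on the meet. *)
  have fm k : meet j j' <<= k -> k <<= l -> supp k != supp l ->
      f k (phi (meet j j') k w) = f (meet j j') w.
    move=> mk kl nk; have Dk := gluing_dom_le G mk kl Dw.
    have [mm|nm] := eqVneq (supp (meet j j')) (supp k).
      by move: (gluing_supp_inj G mm) w Dw Dk => <- w _ _; rewrite (gluing_phi_id G).
    by have [_ _ _] := hf k (ltl k kl nk); apply.
  by rewrite !fm ?meet_lel ?meet_ler.
have hP z : P l z -> h z = p l z by rewrite /h; case: asboolP.
have hphi j x : j <<= l -> supp j != supp l -> D j l x -> h (phi j l x) = f j x.
  move=> jl nj Dx; rewrite /h; case: asboolP => [/P_fresh|_]; first by case.
  have ex : exists r, val_at (phi j l x) r by exists (f j x), j, x.
  have [j' [x' [jl' nj' Dx' e ->]]] := xgetPex 0 ex.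
  by apply/esym; exact: compat.
pose J := [set j | j <<= l /\ supp j != supp l].
pose A := P l `|` \bigcup_(j in J) (phi j l @` D j l).
have finJ : finite_set J by exact: sub_finite_set finT.
(* Only finitely many strata lie below [l], so this is a finite union of closed images. *)
have AC C : closed C -> closed (A `&` h @^-1` C).
  move=> clC.
  rewrite (_ : _ `&` _ = (P l `&` p l @^-1` C) `|`
      \bigcup_(j in J) (phi j l @` (D j l `&` f j @^-1` C))).
    apply: closedU; first exact: p_closed.
    apply: closed_bigcup => // j [jl nj]; apply: (gluing_closed G) => //.
    have [cf _ _ _] := hf j (ltl j jl nj).
    by move/continuous_closedP: cf; apply.
  apply/seteqP; split=> z.
    case=> -[Pz|[j [jl nj] [x Dx <-]]] /=; first by rewrite hP //; left.
    by rewrite hphi // => Cz; right; exists j => //; exists x.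
  case=> [[Pz pz]|[j [jl nj] [x [Dx fx] <-]]].
    by split; [left|rewrite /= hP].
  by split; [right; exists j => //; exists x|rewrite /= hphi].
have clA : closed A by have := AC setT closedT; rewrite preimage_setT setIT.
have hA := closed_preimage_within_continuous AC.
have bA z : A z -> `|h z| <= 1.
  case=> [Pz|[j [jl nj] [x Dx <-]]]; first by rewrite hP.
  by rewrite hphi//; have [_ + _ _] := hf j (ltl j jl nj); apply.
have [g [gh cg g1]] :=
  continuous_bounded_extension (normalV (l := l)) clA ltr01 hA bA.
exists g; split=> //.
  by move=> z Pz; rewrite -gh ?hP// inE; left.
by move=> j x jl nj Dx; rewrite -gh ?hphi// inE; right; exists j => //; exists x.
Qed.

Lemma glued_function_extension : exists f : forall l : T, V l -> R,
  [/\ forall l, continuous (f l), forall l z, P l z -> f l z = p l z &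
      forall j l x, j <<= l -> D j l x -> f l (phi j l x) = f j x].
Proof.
have step n (f : forall l : T, V l -> R) :
    (forall l, (#|supp l| < n)%N -> good f l) ->
    exists f' : forall l : T, V l -> R,
      forall l, (#|supp l| < n.+1)%N -> good f' l.
  move=> hf.
  (* Only the strata with support of size exactly n are redefined. *)
  pose Q l (g : V l -> R) := if (#|supp l| == n)%N then
      [/\ continuous g, forall z, `|g z| <= 1,
          forall z, P l z -> g z = p l z &
          forall j x, j <<= l -> supp j != supp l -> D j l x ->
            g (phi j l x) = f j x]
    else g = f l.
  have hQ l : exists g, Q l g.
    rewrite /Q; case: eqP => [e|_]; last by exists (f l).
    by apply: extend; rewrite e.
  pose f' l := sval (cid (hQ l)).
  have Qf' l : Q l (f' l) := svalP (cid (hQ l)).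
  have f'E l : (#|supp l| < n)%N -> f' l = f l.
    by move=> ln; have := Qf' l; rewrite /Q ltn_eqF.
  have ltl j l : j <<= l -> supp j != supp l -> (#|supp j| < #|supp l|)%N.
    by move=> jl ne; apply: proper_card; rewrite finset.properEneq ne.
  exists f' => l; rewrite ltnS leq_eqVlt => /orP[/eqP ln|ln].
    have := Qf' l; rewrite /Q ln eqxx => -[c b q e]; split=> //.
    by move=> j x jl nj Dx; rewrite (f'E j) -?ln ?ltl//; exact: e.
  have [c b q e] := hf l ln; split; rewrite f'E// => j x jl nj Dx.
  by rewrite f'E ?e// (ltn_trans (ltl j l jl nj)).
have [f hf] : exists f : forall l : T, V l -> R,
    forall l, (#|supp l| < N.+1)%N -> good f l.
  elim: N.+1 => [|n [f hf]]; last exact: step hf.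
  by exists (fun _ _ => 0).
(* Supports have at most [N] elements, so [N.+1] stages reach every stratum. *)
have {}hf l : good f l by apply: hf; rewrite ltnS -[X in (_ <= X)%N]card_ord max_card.
exists f; split=> [l|l z Pz|j l x jl Dx].
- by have [] := hf l.
- by have [_ _ + _] := hf l; apply.
have [e|ne] := eqVneq (supp j) (supp l).
  by move: (gluing_supp_inj G e) Dx => <- _; rewrite (gluing_phi_id G).
by have [_ _ _] := hf l; apply.
Qed.
End Extension.

(** A representative with support of least size works: a preimage in a smaller stratum would be a
    smaller representative. *)
Lemma minimal_representative i (x : V i) : exists i0 (x0 : V i0),
  glued x0 x /\
  forall k l z, k <<= l -> supp k != supp l -> D k l z ->
    existT V l (phi k l z) <> existT V i0 x0.
Proof.
pose Q n := `[< exists k (z : V k), glued z x /\ #|supp k| = n >].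
have exQ : exists n, Q n.
  by exists #|supp i|; apply/asboolP; exists i, x; split; [exact: glued_refl|].
have [m /asboolP[i0 [x0 [x0x mE]]] mmin] := ex_minnP exQ.
exists i0, x0; split=> // k l z kl nk Dz e.
have : (m <= #|supp k|)%N.
  apply/mmin/asboolP; exists k, z; split=> //; apply: glued_trans x0x.
  (* The detour through [projT2] allows rewriting with [e], an equality of dependent pairs. *)
  have : glued z (projT2 (existT V l (phi k l z))) by exact: glued_phi.
  by rewrite e.
have li : l = i0 := congr1 (@projT1 _ _) e.
by rewrite leqNgt -mE -li proper_card// finset.properEneq nk.
Qed.

(** The values 1 and 0 are prescribed at minimal representatives of the two classes; minimality is
    the freshness that the extension requires. *)
Lemma glued_separation (R : realType) i (x : V i) j (y : V j) :
  (forall l, hausdorff_space (V l)) -> (forall l, normal_space (V l)) ->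
  ~ glued x y ->
  exists f : forall l : T, V l -> R,
    [/\ forall l, continuous (f l),
        forall k l z, k <<= l -> D k l z -> f l (phi k l z) = f k z &
        f i x <> f j y].
Proof.
move=> hV nV xy.
have [i0 [x0 [x0x x0min]]] := minimal_representative x.
have [j0 [y0 [y0y y0min]]] := minimal_representative y.
have x0y0 : existT V i0 x0 <> existT V j0 y0.
  move=> e; apply: xy; apply: glued_trans (glued_sym x0x) _.
  suff : glued (projT2 (existT V i0 x0)) y by [].
  by rewrite e.
pose P l : set (V l) :=
  existT V l @^-1` [set existT V i0 x0; existT V j0 y0].
pose p l (z : V l) : R := (`[< existT V l z = existT V i0 x0 >])%:R.
have [||||f [cf fP fphi]] := @glued_function_extension R P p.
- by [].
- move=> l C _; apply: (accessible_finite_set_closed.1 (hausdorff_accessible (hV l))).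
  apply: sub_finite_set (@subIsetl _ _ _) _.
  apply: finite_preimage; last exact: finite_set2.
  by move=> u v _ _; exact: eq_from_Tagged.
- by move=> l z; rewrite /p; case: asboolP => _; rewrite ?normr1 ?normr0.
- by move=> k l z kl nkl Dz [] e; [exact: x0min e|exact: y0min e].
exists f; split=> //.
have inv k (u : V k) l (v : V l) : glued u v -> f k u = f l v.
  by case=> m [km lm Du Dv e]; rewrite -(fphi _ _ _ km Du) e fphi.
rewrite -(inv _ _ _ _ x0x) -(inv _ _ _ _ y0y) !fP; [|by right|by left].
rewrite /p asboolT// asboolF; last by move=> e; exact/x0y0.
by apply/eqP; rewrite oner_eq0.
Qed.
End Gluing.

(** * Topology of Kuranishi charts *)

Section RowVectors.
Variable R : realType.

Lemma rV_linear_continuous (n m : nat) (g : {linear 'rV[R]_n -> 'rV[R]_m}) :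
  continuous g.
Proof.
rewrite (_ : (g : _ -> _) = fun v => \sum_(j < n) v ord0 j *: g 'e_j); last first.
  apply/funext => v; rewrite {1}(row_sum_delta v) linear_sum.
  by apply: eq_bigr => j _; rewrite linearZ.
apply: continuous_big => [|j _ v]; first exact: add_continuous.
apply: (@cvgZr_tmp R 'rV[R]_m _ (nbhs v) _ (fun v : 'rV[R]_n => v ord0 j)).
exact: (@coord_continuous R 1 n ord0 j).
Qed.

Lemma rV_closed_ball_compact (n : nat) (x : 'rV[R]_n) (r : R) : 0 < r ->
  compact (closed_ball x r).
Proof.
move=> r0; apply: bounded_closed_compact; last exact: closed_ball_closed.
exists (`|x| + r); split; first exact: num_real.
move=> M xM v /=; rewrite closed_ballE // /closed_ball_ /= => xv.
apply: le_trans (ltW xM); rewrite -[v](subrK x) addrC.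
by apply: le_trans (ler_normD _ _) _; rewrite lerD2l distrC.
Qed.

Lemma half_space_closed (n : nat) : closed (half_space R n).
Proof.
rewrite (_ : half_space R n = \bigcap_(i in [set i : 'I_n | val i = 0%N])
    (fun v : 'rV[R]_n => v ord0 i) @^-1` [set t | 0 <= t]); last first.
  by apply/seteqP; split=> v h i /=; exact: h.
apply: closed_bigI => i _; move/continuous_closedP: (@coord_continuous R 1 n ord0 i); apply.
exact: closed_ge.
Qed.

Variable E : vectType R.

Lemma v2r_continuous : continuous (v2r : vtop E -> 'rV[R]_(dim E)).
Proof. exact: initial_continuous. Qed.

Lemma r2v_continuous : continuous (r2v : 'rV[R]_(dim E) -> vtop E).
Proof.
apply: continuous_comp_initial.
rewrite (_ : _ \o _ = id); first by move=> v; exact: cvg_id.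
by apply/funext => v /=; rewrite r2vK.
Qed.

Lemma vtop_hausdorff : hausdorff_space (vtop E).
Proof.
move=> x y xy; apply: v2r_inj; apply: (@norm_hausdorff _ 'rV[R]_(dim E)).
move=> A B Ax By.
have [z [Az Bz]] := xy _ _ (v2r_continuous Ax) (v2r_continuous By).
by exists (v2r z).
Qed.

Lemma vtop_compact_ball (x : 'rV[R]_(dim E)) (r : R) : 0 < r ->
  compact (v2r @^-1` closed_ball x r : set (vtop E)).
Proof.
move=> r0; rewrite (_ : _ @^-1` _ = (r2v : _ -> vtop E) @` closed_ball x r).
  apply: continuous_compact; last exact: rV_closed_ball_compact.
  exact/continuous_subspaceT/r2v_continuous.
apply/seteqP; split=> [e xe|_ [v xv <-]]; last by rewrite /= r2vK.
by exists (v2r e) => //; exact: v2rK.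
Qed.

Lemma vtop_locally_compact (x : vtop E) : exists2 C, compact C & nbhs x C.
Proof.
exists (v2r @^-1` closed_ball (v2r (x : E)) 1); first exact: vtop_compact_ball.
by apply: v2r_continuous; apply/nbhs_closedballP; exists 1%:pos.
Qed.

Lemma vtop_sigma_compact : exists2 C : nat -> set (vtop E),
  (forall n, compact (C n)) & \bigcup_n C n = setT.
Proof.
exists (fun n => v2r @^-1` closed_ball 0 n.+1%:R) => [n|].
  exact: vtop_compact_ball.
apply/seteqP; split=> // e _; have [n en] : exists n, `|v2r (e : E)| < n%:R.
  by exists (Num.trunc `|v2r (e : E)|).+1; rewrite truncnS_gt.
exists n => //=; rewrite closed_ballE// /closed_ball_/= sub0r normrN ltW//.
by rewrite (lt_trans en)// ltr_nat.
Qed.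

End RowVectors.

Lemma hom_continuous (R : realType) (E F : vectType R) (f : 'Hom(E, F)) :
  continuous (f : vtop E -> vtop F).
Proof.
apply: continuous_comp_initial.
pose g := v2r \o (f \o r2v) : 'rV[R]_(dim E) -> 'rV[R]_(dim F).
rewrite (_ : _ \o _ = g \o (v2r : vtop E -> _)); last first.
  by apply/funext => e; rewrite /g /= v2rK.
move=> e; apply: continuous_comp; first exact: v2r_continuous.
exact: (@rV_linear_continuous R _ _ g).
Qed.

Lemma limg_closed (R : realType) (E F : vectType R) (f : 'Hom(E, F)) :
  closed [set e : vtop F | (e : F) \in limg f].
Proof.
(* The image of [f] is the kernel of the complementary projection. *)
pose p := (\1 - projv (limg f))%VF.
rewrite (_ : [set _ | _] = (p : vtop F -> vtop F) @^-1` [set (0 : F)]).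
  move/continuous_closedP: (@hom_continuous _ _ _ p); apply.
  exact/accessible_closed_set1/hausdorff_accessible/vtop_hausdorff.
apply/seteqP; split=> e /=; rewrite add_lfunE opp_lfunE id_lfunE.
  by move=> ef; rewrite projv_id// subrr.
by move=> /eqP; rewrite subr_eq0 => /eqP ->; exact: memv_proj.
Qed.

Lemma homeo_onto_inverse (T T' : topologicalType) (A : set T) (B : set T')
    (f : T -> T') (x0 : T) : homeo_onto A B f ->
  exists g : T' -> T, [/\ {within B, continuous g},
    forall x, A x -> g (f x) = x & forall y, B y -> A (g y) /\ f (g y) = y].
Proof.
case=> -[fAB finj fsurj] _ fopen.
have [g gB] : exists g : T' -> T, forall y, B y -> A (g y) /\ f (g y) = y.
  (* The default [x0] is taken only off [B]. *)
  exists (fun y => xget x0 [set x | A x /\ f x = y]) => y /fsurj[x Ax fx].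
  exact: (xgetPex x0 (ex_intro [set z | A z /\ f z = y] x (conj Ax fx))).
have gA x : A x -> g (f x) = x.
  by move=> Ax; have [Ag fg] := gB _ (fAB _ Ax); apply: finj; rewrite ?inE.
exists g; split=> //; apply/continuousP => O oO; apply/open_subspaceP.
have [W oW fW] := fopen O oO; exists W => //.
rewrite setIC -fW; apply/seteqP; split=> y.
  case=> x [Ax Ox] <-; split; last exact: fAB.
  by move: Ox; rewrite -{1}(gA x Ax).
by case=> /= Og By; have [Ag fg] := gB y By; exists (g y).
Qed.

Section Charts.
Variable R : realType.

(** Interior and boundary charts are treated together: the chart image is [V] cut by a closed set
    [H], the whole space or the half-space. The inverse chart carries a closed ball in [V], cut by
    [H], to a compact neighbourhood. *)
Lemma mchart_compact_nbhs (T : topologicalType) (n : nat) (c : mchart R T n)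
    (x : T) :
  mchart_axiom c -> mc_dom c x -> exists2 C, compact C & nbhs x C.
Proof.
case=> oD [V oV cV] Dx.
have [H cH cVH] : exists2 H, closed H &
    homeo_onto (mc_dom c) (V `&` H) (mc_map c).
  case: cV => h; last by exists (half_space R n); [exact: half_space_closed|].
  by exists setT; [exact: closedT|rewrite setIT].
have [g [cg gK _]] := homeo_onto_inverse x cVH.
have [[fAB _ _] cf _] := cVH.
have [Vx Hx] := fAB _ Dx.
have /nbhs_closedballP[r rV] : nbhs (mc_map c x) V by exact: open_nbhs_nbhs.
pose B := closed_ball (mc_map c x) r%:num.
exists (g @` (B `&` H)).
  apply: continuous_compact.
    apply: continuous_subspaceW cg => y [By Hy]; split=> //; exact: rV.
  by apply: compact_closedI => //; exact: rV_closed_ball_compact.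
have fx : {for x, continuous (mc_map c)}.
  by move: cf; rewrite continuous_open_subspace// => /(_ x); apply; rewrite inE.
have Bx : nbhs (mc_map c x) B by apply/nbhs_closedballP; exists r.
have Dn : nbhs x (mc_dom c) by exact: open_nbhs_nbhs.
apply: filterS2 Dn (fx _ Bx) => z Dz Bz; exists (mc_map c z); last exact: gK.
by split=> //; have [] := fAB _ Dz.
Qed.

Variable M : manifold R.

Lemma manifold_locally_compact (x : M) : exists2 C, compact C & nbhs x C.
Proof.
by have [c Mc cx] := matlas_cover x; exact: mchart_compact_nbhs (matlas_chart Mc) cx.
Qed.

Lemma manifold_sigma_compact : exists2 C : nat -> set M,
  (forall n, compact (C n)) & \bigcup_n C n = setT.
Proof.
apply: second_countable_sigma_compact; first exact: manifold_hausdorff.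
- exact: manifold_locally_compact.
- exact: manifold_second_countable.
Qed.

Variable E : vectType R.

Lemma smooth_section_continuous (s : M -> E) :
  smooth_section s -> continuous (s : M -> vtop E).
Proof.
move=> ss x; have [c Mc cx] := matlas_cover x.
have [oD [V oV cV]] := matlas_chart Mc.
have cf : {within mc_dom c, continuous (mc_map c)} by case: cV => -[].
have fx : {for x, continuous (mc_map c)}.
  by move: cf; rewrite continuous_open_subspace// => /(_ x); apply; rewrite inE.
have [g [P [oP Px sg gE]]] := ss x c (conj Mc cx).
have gx : {for mc_map c x, continuous g}.
  (* The empty list of directions gives differentiability of [g] itself. *)
  exact/differentiable_continuous/(sg [::]).
have gE' : \forall y \near x, v2r (s y) = g (mc_map c y).
  by move: gE; rewrite near_withinE => h; near=> y; exact: (near h y).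
move=> U [W [[W' oW' <-] /= Wx WU]].
apply: (@filterS _ (nbhs x) _ (s @^-1` (v2r @^-1` W'))); first by move=> y /WU.
have W'x : nbhs (g (mc_map c x)) W'.
  by rewrite -(nbhs_singleton gE'); exact: open_nbhs_nbhs.
by apply: filterS2 gE' (continuous_comp fx gx W'x) => y; rewrite /preimage/= => ->.
Unshelve. all: by end_near. Qed.

Lemma bundle_hausdorff : hausdorff_space (M * vtop E)%type.
Proof.
by apply: hausdorff_prod; [exact: manifold_hausdorff|exact: vtop_hausdorff].
Qed.

Lemma bundle_normal : normal_space (M * vtop E)%type.
Proof.
have [C cC CT] := manifold_sigma_compact.
have [B cB BT] := vtop_sigma_compact E.
(* Products of the two exhausting families are enumerated through codes of pairs; a number coding no
   pair gives the empty set. *)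
pose K n : set (M * vtop E)%type :=
  if unpickle n is Some (k, l) then C k `*` B l else set0.
apply: (@regular_sigma_compact_normal _ R K) => [|n|].
- apply: locally_compact_regular; first exact: bundle_hausdorff.
  move=> [x e]; have [P cP xP] := manifold_locally_compact x.
  have [Q cQ eQ] := vtop_locally_compact e.
  by exists (P `*` Q); [exact: compact_setX|exists (P, Q)].
- rewrite /K; case: unpickle => [[k l]|]; last exact: compact0.
  exact: compact_setX.
apply/seteqP; split=> // -[x e] _.
have [k _ Ck] : (\bigcup_n C n) x by rewrite CT.
have [l _ Bl] : (\bigcup_n B n) e by rewrite BT.
by exists (pickle (k, l)) => //; rewrite /K pickleK.
Qed.

End Charts.

(** * The glued system of a tame atlas *)

Section Atlas.
Variables (R : realType) (X : topologicalType) (d : int) (K : kdata R X).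
Hypothesis hausdorffX : hausdorff_space X.
Hypothesis compactX : compact [set: X].
Hypothesis chartK : forall I : kidx K, chart_core (kK I).
Hypothesis openF : forall I : kidx K, open (footprint (kK I)).
Hypothesis coreK : atlas_core d K.
Hypothesis changeK : forall I J : kidx K, ipsub I J ->
  coordinate_change (kdom I J) (kphi I J) (khat I J).
Hypothesis tameK : tame K.

Implicit Types I J L H : kidx K.

(** * Cocycle and tameness conditions, with equal indices allowed *)

Lemma isub_eqVlt I J : isub I J -> I = J \/ ipsub I J.
Proof.
rewrite /isub /ipsub finset.properEneq => ->; rewrite andbT.
by case: eqVneq => [/val_inj|]; [left|right].
Qed.

Lemma footprintE I : footprint (kK I) = inter_footprint (kF K) (val I).
Proof. by case: coreK => _ + _ _ => /(_ I)[]. Qed.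

Lemma footprint_sub I J : isub I J -> footprint (kK J) `<=` footprint (kK I).
Proof.
rewrite !footprintE => /fintype.subsetP IJ x Jx i Ii; exact/Jx/IJ.
Qed.

Lemma kdom_id I x : kdom I I x.
Proof. by case: coreK => _ _ + _ => /(_ I)[-> _ _]. Qed.

Lemma kphi_id I x : kphi I I x = x.
Proof. by case: coreK => _ _ + _ => /(_ I)[_ -> _]. Qed.

Lemma khat_id I e : khat I I e = e.
Proof. by case: coreK => _ _ + _ => /(_ I)[_ _ ->]; rewrite id_lfunE. Qed.

(** The first tameness identity applies with J u L = L. *)
Lemma kdom_le I J L x : isub I J -> isub J L -> kdom I L x -> kdom I J x.
Proof.
move=> IJ JL Lx; case: tameK => _ + _ => /(_ I J L IJ (fintype.subset_trans IJ JL)).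
move/seteqP => [_ /(_ x)] []//.
by exists L => //; apply/esym/finset.setUidPr.
Qed.

Lemma kphi_image I J L : isub I J -> isub J L ->
  kphi I J @` kdom I L =
  kdom J L `&` [set y | cs (kK J) y \in limg (khat I J)].
Proof. by case: tameK => _ _; apply. Qed.

(** One direction is the domain inclusion in the cocycle condition; the other is the tameness
    identity for the image of U_IL under the coordinate change. *)
Lemma kdom_phi I J L x : isub I J -> isub J L -> kdom I J x ->
  kdom J L (kphi I J x) <-> kdom I L x.
Proof.
move=> IJ JL Dx; split=> [|Lx]; last first.
  have : (kphi I J @` kdom I L) (kphi I J x) by exists x.
  by rewrite kphi_image// => -[].
case: (isub_eqVlt IJ) => [e|pIJ]; first by subst J; rewrite kphi_id.
case: (isub_eqVlt JL) => [e|pJL]; first by subst L.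
by case: coreK => _ _ _ /(_ I J L pIJ pJL) [_ + _] Lx; apply.
Qed.

Lemma kphi_comp I J L x : isub I J -> isub J L -> kdom I L x ->
  kphi J L (kphi I J x) = kphi I L x.
Proof.
move=> IJ JL Lx; have Dx := kdom_le IJ JL Lx.
case: (isub_eqVlt IJ) => [e|pIJ]; first by subst J; rewrite kphi_id.
case: (isub_eqVlt JL) => [e|pJL]; first by subst L; rewrite kphi_id.
case: coreK => _ _ _ /(_ I J L pIJ pJL) [_ _]; apply=> //.
exact/(kdom_phi IJ JL).
Qed.

Lemma khat_comp I J L e : isub I J -> isub J L ->
  khat J L (khat I J e) = khat I L e.
Proof.
move=> IJ JL.
case: (isub_eqVlt IJ) => [E|pIJ]; first by subst J; rewrite khat_id.
case: (isub_eqVlt JL) => [E|pJL]; first by subst L; rewrite khat_id.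
by case: coreK => _ _ _ /(_ I J L pIJ pJL) [<- _ _]; rewrite comp_lfunE.
Qed.

Lemma khat_inj I J : isub I J -> injective (khat I J).
Proof.
move=> IJ; case: (isub_eqVlt IJ) => [E|/changeK[_ _ [_ k0] _ _]].
  by subst J => x y; rewrite !khat_id.
by apply/lker0P/eqP.
Qed.

Lemma kdom_open I J : isub I J -> open (kdom I J).
Proof.
move=> IJ; case: (isub_eqVlt IJ) => [E|/changeK[_ [oD _] _ _ _]//].
rewrite (_ : kdom I J = setT); first exact: openT.
by subst J; apply/seteqP; split=> // x _; exact: kdom_id.
Qed.

Lemma kphi_homeo I J : isub I J ->
  homeo_onto (kdom I J) (kphi I J @` kdom I J) (kphi I J).
Proof.
move=> IJ; case: (isub_eqVlt IJ) => [E|/changeK[_ _ [[_ _ h] _] _ _]//].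
subst J; have -> : kphi I I = id by apply/funext => x; exact: kphi_id.
rewrite image_id; split.
- by split=> // x Dx; exists x.
- by apply: continuous_subspaceT => x; exact: cvg_id.
- by move=> O oO; exists O => //; rewrite image_id.
Qed.

Lemma kphi_inj I J x y : isub I J -> kdom I J x -> kdom I J y ->
  kphi I J x = kphi I J y -> x = y.
Proof.
move=> /kphi_homeo[[_ inj _] _ _] Dx Dy; apply: inj; exact: mem_set.
Qed.

Lemma kphi_continuous I J x : isub I J -> kdom I J x ->
  {for x, continuous (kphi I J)}.
Proof.
move=> IJ Dx; have [_ + _] := kphi_homeo IJ.
rewrite continuous_open_subspace; last exact: kdom_open.
by apply; exact: mem_set.
Qed.

Lemma cs_kphi I J x : isub I J -> kdom I J x ->
  cs (kK J) (kphi I J x) = khat I J (cs (kK I) x).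
Proof.
move=> IJ Dx; case: (isub_eqVlt IJ) => [E|/changeK[_ _ _ [+ _] _]]; last exact.
by subst J; rewrite kphi_id khat_id.
Qed.

Lemma cpsi_kphi I J x : isub I J -> kdom I J x -> cs (kK I) x = 0 ->
  cpsi (kK J) (kphi I J x) = cpsi (kK I) x.
Proof.
move=> IJ Dx x0; case: (isub_eqVlt IJ) => [E|/changeK[_ _ _ [_ h] _]].
  by subst J; rewrite kphi_id.
exact: h.
Qed.

Lemma kdom_zero I J x : isub I J -> cs (kK I) x = 0 ->
  kdom I J x <-> footprint (kK J) (cpsi (kK I) x).
Proof.
move=> IJ x0; case: (isub_eqVlt IJ) => [E|/changeK[_ [_ /seteqP[h1 h2]] _ _ _]].
  subst J; split=> _; first by exists x.
  exact: kdom_id.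
split=> [Dx|Fx]; first by have [//|_ []] := h1 x.
by have [|//] := h2 x; split=> //; split=> //; exists x.
Qed.

Lemma cs_continuous I : continuous (cs (kK I) : kU I -> vtop (kE I)).
Proof. by apply: smooth_section_continuous; have [] := chartK I. Qed.

(** This is tameness with L = J. It cuts out the image of a coordinate change by a closed condition
    on the section. *)
Lemma kphi_range I J : isub I J ->
  kphi I J @` kdom I J = [set y | cs (kK J) y \in limg (khat I J)].
Proof.
move=> IJ; rewrite (kphi_image IJ (subxx _)).
by apply/seteqP; split=> y; [case|split=> //; exact: kdom_id].
Qed.

(** The family [f] is indexed by all basic charts, so that the same family can be summed in E_I and
    in a larger E_L. *)
Let kidx_sum I (f : forall i, kE (isingle i : kidx K)) : kE I :=
  \sum_(i in val I) khat (isingle i) I (f i).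

Lemma isingle_sub i I : i \in val I -> isub (isingle i : kidx K) I.
Proof. by move=> iI; rewrite /isub /= finset.sub1set. Qed.

Lemma khat_sum I L f : isub I L ->
  khat I L (kidx_sum I f) = \sum_(i in val I) khat (isingle i) L (f i).
Proof.
move=> IL; rewrite linear_sum; apply: eq_bigr => i iI.
by apply: khat_comp => //; exact: isingle_sub.
Qed.

Lemma kidx_sum_surj I (e : kE I) : exists f,
  (forall i, i \notin val I -> f i = 0) /\ e = kidx_sum I f.
Proof.
case: tameK => + _ _ => /(_ I) [g _ gK].
(* The family is extended by zero off I; [decP] supplies the membership proof that [g e] takes as
   argument. *)
pose f i : kE (isingle i : kidx K) :=
  if decP (@idP (i \in val I)) is left p then g e (exist _ i p) else 0.
exists f; split; first by move=> i /negP; rewrite /f; case: decP.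
rewrite /kidx_sum [RHS]big_sub -{1}[e]gK; apply: eq_bigr => -[i p] _ /=; congr (khat _ _ _).
by rewrite /f; case: decP => // p'; congr (g e (exist _ _ _)); exact: bool_irrelevance.
Qed.

Lemma kidx_sum_inj I f g : kidx_sum I f = kidx_sum I g ->
  forall i, i \in val I -> f i = g i.
Proof.
rewrite /kidx_sum [LHS]big_sub [RHS]big_sub => e i iI.
case: tameK => /(_ I)/bij_inj inj _ _.
have := inj (fun i => f (val i)) (fun i => g (val i)) e.
by move/(congr1 (fun h => h (exist _ i iI))).
Qed.

Lemma kidx_sum_restrict I H f : isub H I ->
  (forall i, i \in val I -> i \notin val H -> f i = 0) ->
  kidx_sum I f = \sum_(i in val H) khat (isingle i : kidx K) I (f i).
Proof.
move=> /fintype.subsetP HI f0; rewrite /kidx_sum (bigID (mem (val H)))/=.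
rewrite [X in _ + X]big1 ?addr0; last by move=> i /andP[iI /f0->//]; rewrite linear0.
by apply: eq_bigl => i; case iH : (i \in val H); rewrite ?andbF// HI.
Qed.

(** By additivity the components of [v] in E_L are unique, so those outside I and those outside J
    all vanish. The case of empty intersection is separate, as no index [H] then exists. *)
Lemma limg_khat_inter I J L v : isub I L -> isub J L ->
  v \in limg (khat I L) -> v \in limg (khat J L) ->
  (val I :&: val J = finset.set0 -> v = 0) /\
  (forall H, val H = (val I :&: val J)%SET -> v \in limg (khat H L)).
Proof.
move=> IL JL /memv_imgP[a _ va] /memv_imgP[b _ vb].
have [f [f0 af]] := kidx_sum_surj a; have [g [g0 bg]] := kidx_sum_surj b.
have vf : v = kidx_sum L f.
  rewrite va af khat_sum// -kidx_sum_restrict// => i _; exact: f0.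
have vg : v = kidx_sum L g.
  rewrite vb bg khat_sum// -kidx_sum_restrict// => i _; exact: g0.
have fg := kidx_sum_inj (etrans (esym vf) vg).
have f0' i : i \in val L -> i \notin (val I :&: val J)%SET -> f i = 0.
  by move=> iL; rewrite finset.inE negb_and => /orP[/f0|/g0 <-]//; exact: fg.
split=> [IJ0|H HE].
  rewrite vf /kidx_sum big1// => i iL.
  by rewrite f0' ?linear0// IJ0 finset.inE.
have HL : isub H L.
  by rewrite /isub HE (fintype.subset_trans (finset.subsetIl _ _)).
rewrite vf (kidx_sum_restrict HL) -?khat_sum ?memv_img ?memvf//.
by move=> i iL; rewrite HE; exact: f0'.
Qed.

(** * Inverse footprint maps *)

Lemma cpsi_inverse I : exists g : X -> kU I,
  [/\ {within footprint (kK I), continuous g},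
      forall x, cs (kK I) x = 0 -> g (cpsi (kK I) x) = x &
      forall p, footprint (kK I) p -> cs (kK I) (g p) = 0 /\ cpsi (kK I) (g p) = p].
Proof.
have [_ homeo] := chartK I.
(* Members of the index set have nonempty footprint, which supplies the default point of the
   inverse. *)
have [_ [x _ _]] : footprint (kK I) !=set0.
  rewrite footprintE; by have /andP[_ /asboolP] := svalP I.
have [g [cg gK fK]] := homeo_onto_inverse x homeo.
by exists g; split=> //.
Qed.

Definition psi_inv I : X -> kU I := sval (cid (cpsi_inverse I)).

Lemma psi_inv_continuous I : {within footprint (kK I), continuous (psi_inv I)}.
Proof. by rewrite /psi_inv; case: cid => g []. Qed.

Lemma cpsiK I x : cs (kK I) x = 0 -> psi_inv I (cpsi (kK I) x) = x.
Proof. by rewrite /psi_inv; case: cid => g /= [_ + _]; apply. Qed.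

Lemma cs_psi_inv I p : footprint (kK I) p -> cs (kK I) (psi_inv I p) = 0.
Proof. by rewrite /psi_inv; case: cid => g /= [_ _ h] /h[]. Qed.

Lemma psi_invK I p : footprint (kK I) p -> cpsi (kK I) (psi_inv I p) = p.
Proof. by rewrite /psi_inv; case: cid => g /= [_ _ h] /h[]. Qed.

(** This is the cocycle condition starting from the empty index. *)
Lemma kphi_psi_inv I J p : isub I J -> footprint (kK J) p ->
  kdom I J (psi_inv I p) /\ kphi I J (psi_inv I p) = psi_inv J p.
Proof.
move=> IJ Fp; have Fp' := footprint_sub IJ Fp.
have D : kdom I J (psi_inv I p).
  by apply/(kdom_zero IJ); rewrite ?psi_invK//; exact: cs_psi_inv.
split=> //; rewrite -[LHS]cpsiK.
  by rewrite cpsi_kphi ?psi_invK//; exact: cs_psi_inv.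
by rewrite cs_kphi// cs_psi_inv// linear0.
Qed.

(* [None] stands for the empty index, with domain X; [sdom (Some _) None] and
   [sphi (Some _) None] are junk values. *)
Definition stratum : choiceType := option (kidx K).

Definition sset (i : stratum) : {set 'I_(kN K)} :=
  if i is Some A then val A else finset.set0.

Definition smeet (i j : stratum) : stratum := insub (sset i :&: sset j)%SET.

Definition sdomain (i : stratum) : topologicalType :=
  if i is Some A then bundle_dom A else X.

Definition sdom (i j : stratum) : set (sdomain i) :=
  match i, j return set (sdomain i) with
  | Some A, Some B => [set xe : bundle_dom A | kdom A B xe.1]
  | None, Some B => footprint (kK B)
  | Some _, None => set0
  | None, None => setT
  end.

Definition sphi (i j : stratum) : sdomain i -> sdomain j :=
  match i, j return sdomain i -> sdomain j with
  | Some A, Some B => fun xe : bundle_dom A => (kphi A B xe.1, khat A B xe.2)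
  | None, Some B => fun p => (psi_inv B p, 0)
  | Some A, None => fun xe : bundle_dom A => cpsi (kK A) xe.1
  | None, None => id
  end.
Arguments sdom : clear implicits.
Arguments sphi : clear implicits.

(** * Verification of the gluing axioms *)

Lemma val_neq0 I : val I != finset.set0.
Proof. by case: I => A /= /andP[]. Qed.

Lemma sset_inj : injective sset.
Proof.
move=> [I|] [J|] //=; first by move/val_inj => ->.
  by move=> e; move/eqP: (val_neq0 I).
by move=> e; move/eqP: (val_neq0 J); case.
Qed.

(** [insub] returns [None] only for an empty intersection: a nonempty one is an index, because its
    footprint contains that of I. *)
Lemma sset_meet i j : sset (smeet i j) = (sset i :&: sset j)%SET.
Proof.
rewrite /smeet; case: insubP => [I _ <-//|] /=.
have [->//|ne] := eqVneq (sset i :&: sset j)%SET finset.set0.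
case: i j ne => [I|] [J|] /=; rewrite ?finset.set0I ?finset.setI0 ?eqxx// => ne.
have /andP[_ /asboolP[x Fx]] := svalP I.
by move=> /asboolPn nF; case: nF; exists x => i; rewrite finset.inE => /andP[iI _]; exact: Fx.
Qed.

Lemma not_sset_sub0 I : ~ sset (Some I) \subset sset None.
Proof. by apply/negP; rewrite finset.subset0 val_neq0. Qed.

Lemma sdom_le i j l x : sset i \subset sset j -> sset j \subset sset l ->
  sdom i l x -> sdom i j x.
Proof.
case: i x => [I|] x; case: j => [J|]; case: l => [L|] //=.
- exact: kdom_le.
- by move=> /not_sset_sub0.
- by move=> _ JL; exact: (footprint_sub (JL : isub J L)).
- by move=> _ /not_sset_sub0.
Qed.

Lemma sdom_phi i j l x : sset i \subset sset j -> sset j \subset sset l ->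
  sdom i j x -> sdom j l (sphi i j x) <-> sdom i l x.
Proof.
case: i x => [I|] x; case: j => [J|]; case: l => [L|] // IJ JL Dx;
  try by [case: (not_sset_sub0 IJ)|case: (not_sset_sub0 JL)].
- exact: kdom_phi.
- by rewrite [X in X <-> _](kdom_zero JL) ?psi_invK//; exact: cs_psi_inv.
Qed.

Lemma sphi_comp i j l x : sset i \subset sset j -> sset j \subset sset l ->
  sdom i l x -> sphi j l (sphi i j x) = sphi i l x.
Proof.
case: i x => [I|] x; case: j => [J|]; case: l => [L|] // IJ JL Dx;
  try by [case: (not_sset_sub0 IJ)|case: (not_sset_sub0 JL)].
- by rewrite /= kphi_comp// khat_comp.
- by have [_ e] := kphi_psi_inv JL Dx; rewrite /= e linear0.
Qed.

Lemma sphi_inj i j x y : sset i \subset sset j -> sdom i j x -> sdom i j y ->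
  sphi i j x = sphi i j y -> x = y.
Proof.
case: i x y => [I|] x y; case: j => [J|] // IJ Dx Dy;
  try by case: (not_sset_sub0 IJ).
- case: x y Dx Dy => [x e] [y f] /= Dx Dy [].
  by move=> /(kphi_inj IJ Dx Dy) -> /(khat_inj IJ) ->.
- by case=> /(congr1 (cpsi (kK J))); rewrite !psi_invK.
Qed.

Lemma sphi_open i j (O : set (sdomain j)) : sset i \subset sset j -> open O ->
  open (sdom i j `&` sphi i j @^-1` O).
Proof.
case: i => [I|]; case: j O => [J|] O IJ oO.
- rewrite openE => -[x e] [/= Dx Ox].
  have Dn : nbhs x (kdom I J) by exact/open_nbhs_nbhs/(conj (kdom_open IJ) Dx).
  have [[P Q] [Px Qe] PQ] : nbhs (kphi I J x, khat I J e : vtop _) O.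
    exact: open_nbhs_nbhs.
  exists (kdom I J `&` kphi I J @^-1` P, khat I J @^-1` Q).
    split=> /=; last exact: (@hom_continuous _ _ _ (khat I J) e).
    by apply: filterI => //; exact: kphi_continuous.
  by move=> [y f] [/= [Dy Py] Qf]; split=> //; exact: PQ.
- by rewrite /= set0I; exact: open0.
- rewrite openE => p [/= Fp Op].
  have Fn : nbhs p (footprint (kK J)) by exact/open_nbhs_nbhs/(conj (openF J) Fp).
  have [[P Q] [Px Qe] PQ] : nbhs (psi_inv J p, 0 : vtop (kE J)) O.
    exact: open_nbhs_nbhs.
  have pc : {for p, continuous (psi_inv J)}.
    have := @psi_inv_continuous J; rewrite continuous_open_subspace//.
    by apply; exact: mem_set.
  apply: filterS2 Fn (pc _ Px) => q Fq Pq; split=> //; apply: PQ; split=> //=.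
  exact: nbhs_singleton Qe.
- by rewrite /= setTI.
Qed.

(** The complement is open at (y, f). If [y] or [f] is outside the range of its map, that range is
    closed and can be avoided; otherwise the point has a unique preimage, and a neighbourhood of
    that preimage missing [C] is carried over. *)
Lemma closed_kphi_khat I J (C : set (bundle_dom I)) : isub I J -> closed C ->
  closed (sphi (Some I) (Some J) @` (sdom (Some I) (Some J) `&` C)).
Proof.
move=> IJ clC; rewrite -[X in closed X]setCK; apply: open_closedC.
set S := _ @` _; rewrite openE => -[y f] nS; rewrite /interior.
have clr : closed [set z : kU J | cs (kK J) z \in limg (khat I J)].
  exact: ((continuous_closedP _).1 (@cs_continuous J) _
    (@limg_closed _ _ _ (khat I J))).
have [yr|nyr] :=
    pselect ([set z : kU J | cs (kK J) z \in limg (khat I J)] y); last first.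
  exists (~` [set z : kU J | cs (kK J) z \in limg (khat I J)], setT).
    split=> /=; last exact: filterT.
    by apply: open_nbhs_nbhs; split=> //; exact: closed_openC.
  move=> [z h] [/= nz _] [[x e] [/= Dx _] [xz _]]; apply: nz.
  by rewrite -xz cs_kphi// memv_img ?memvf.
have [fr|nfr] := boolP (f \in limg (khat I J)); last first.
  exists (setT, ~` [set h : vtop _ | (h : kE J) \in limg (khat I J)]).
    split=> /=; first exact: filterT.
    by apply: open_nbhs_nbhs; split; [exact/closed_openC/limg_closed|exact/negP].
  move=> [z h] [_ /= nh] [[x e] _ [_ eh]]; apply: nh.
  by rewrite -eh memv_img ?memvf.
move: yr; rewrite -kphi_range// => -[x Dx xy].
have [e _ ef] := memv_imgP fr; subst f y.
have nC : nbhs (x, e : vtop (kE I)) (~` C).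
  apply: open_nbhs_nbhs; split; first exact: closed_openC.
  by move=> Cxe; apply: nS; exists (x, e).
have [[P Q] [/= Px Qe] PQ] := nC.
have [_ _ /(_ _ (@open_interior _ P))[P' oP' PE]] := kphi_homeo IJ.
(* A linear left inverse is defined on all of E_J, so it pulls [Q] back to a neighbourhood there. *)
have khK : cancel (khat I J) (khat I J)^-1%VF.
  by apply: lker0_lfunK; apply/lker0P; exact: khat_inj.
exists (P', (khat I J)^-1%VF @^-1` Q).
  split=> /=.
    apply: open_nbhs_nbhs; split=> //.
    have : (kphi I J @` (kdom I J `&` P°)) (kphi I J x) by exists x.
    by rewrite PE => -[].
  by apply: (@hom_continuous _ _ _ (khat I J)^-1%VF); rewrite khK.
move=> [z h] [/= P'z Qh] [[x' e'] [/= Dx' Cx'] [xz eh]]; subst z h.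
move: Qh; rewrite khK => Qe'.
have : (kphi I J @` kdom I J `&` P') (kphi I J x') by split=> //; exists x'.
rewrite -PE => -[x'' [Dx'' Px''] /(kphi_inj IJ Dx'' Dx') ex]; subst x''.
by apply: (PQ (x', e')) => //; split=> //=; exact: interior_subset.
Qed.

(** The image consists of the points (x, 0) with [x] a zero of the section lying over [C]; the zero
    set is closed and the footprint map is continuous on it. *)
Lemma closed_psi_inv J (C : set X) : closed C ->
  closed (sphi None (Some J) @` (sdom None (Some J) `&` C)).
Proof.
move=> clC; have [_ [_ /continuous_closedP + _]] := chartK J.
move=> /(_ C clC)/closed_subspaceP[V clV VC].
have cl0 : closed [set (0 : kE J) : vtop (kE J)].
  exact/accessible_closed_set1/hausdorff_accessible/vtop_hausdorff.
have clz : closed (zero_set (kK J)).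
  exact: ((continuous_closedP _).1 (@cs_continuous J) _ cl0).
rewrite (_ : _ @` _ = (fst @^-1` (V `&` zero_set (kK J)) `&`
    snd @^-1` [set 0] : set (bundle_dom J))).
  apply: closedI.
    have /continuous_closedP : continuous (fst : bundle_dom J -> kU J).
      by move=> z; exact: cvg_fst.
    by apply; exact: closedI.
  have /continuous_closedP : continuous (snd : bundle_dom J -> vtop (kE J)).
    by move=> z; exact: cvg_snd.
  exact.
rewrite VC; apply/seteqP; split.
  move=> _ [p [Fp Cp] <-]; split=> //; split=> /=; last exact: cs_psi_inv.
  by change (C (cpsi (kK J) (psi_inv J p))); rewrite psi_invK.
move=> [x e] [[/= Cx x0] /= e0]; subst e.
exists (cpsi (kK J) x); last by rewrite /= cpsiK.
by split=> //; exists x.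
Qed.

Lemma sphi_closed i j (C : set (sdomain i)) : sset i \subset sset j -> closed C ->
  closed (sphi i j @` (sdom i j `&` C)).
Proof.
case: i C => [I|]; case: j => [J|] C IJ clC.
- exact: closed_kphi_khat.
- by case: (not_sset_sub0 IJ).
- exact: closed_psi_inv.
- by rewrite /= setTI image_id.
Qed.

Lemma sphi_inter_le i j l x y : sset i \subset sset j -> sset j \subset sset l ->
  sdom i l x -> sdom j l y -> sphi i l x = sphi j l y -> sphi i j x = y.
Proof.
move=> ij jl Dx Dy xy; apply: (sphi_inj jl) => //.
  by apply/sdom_phi => //; exact: sdom_le Dx.
by rewrite sphi_comp.
Qed.

Lemma sdom_id i x : sdom i i x.
Proof. by case: i x => [I|] //= x; exact: kdom_id. Qed.

Lemma sphi_id i x : sphi i i x = x.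
Proof. by case: i x => [I|] //= [x e]; rewrite kphi_id khat_id. Qed.

Lemma smeet_sub i j : sset i \subset sset j -> smeet i j = i /\ smeet j i = i.
Proof.
move=> ij; split; apply: sset_inj; rewrite sset_meet; first exact/finset.setIidPl.
exact/finset.setIidPr.
Qed.

(** Apart from nested supports, both indices are nonempty. The section at the common image and the
    common vector then lie in the images of both E_I and E_J, to which [limg_khat_inter] applies. *)
Lemma sphi_inter i j l x y : sset i \subset sset l -> sset j \subset sset l ->
  sdom i l x -> sdom j l y -> sphi i l x = sphi j l y ->
  exists w, [/\ sdom (smeet i j) l w, sphi (smeet i j) i w = x &
                sphi (smeet i j) j w = y].
Proof.
move=> il jl Dx Dy xy.
have [ij|nij] := boolP (sset i \subset sset j).
  have [-> _] := smeet_sub ij; exists x; split; rewrite ?sphi_id//.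
  exact: sphi_inter_le xy.
have [ji|nji] := boolP (sset j \subset sset i).
  have [_ ->] := smeet_sub ji; exists y; split; rewrite ?sphi_id//.
  exact: sphi_inter_le (esym xy).
case: i x il Dx xy nij nji => [I|] x il Dx xy nij nji; last first.
  by rewrite /= finset.sub0set in nij.
case: j y jl Dy xy nij nji => [J|] y jl Dy xy nij nji; last first.
  by rewrite /= finset.sub0set in nji.
case: l il jl Dx Dy xy => [L|] IL JL Dx Dy xy; last by case: (not_sset_sub0 IL).
case: x y Dx Dy xy => [x e] [y f] /= Dx Dy [xy ef].
have kr H w : isub H L -> kdom H L w ->
    cs (kK L) (kphi H L w) \in limg (khat H L).
  by move=> HL Dw; rewrite cs_kphi// memv_img ?memvf.
have csI := kr I x IL Dx.
have csJ : cs (kK L) (kphi I L x) \in limg (khat J L) by rewrite xy; exact: kr.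
have [cs0 csH] := limg_khat_inter IL JL csI csJ.
have eI : khat I L e \in limg (khat I L) by rewrite memv_img ?memvf.
have eJ : khat I L e \in limg (khat J L) by rewrite ef memv_img ?memvf.
have [e0 eH] := limg_khat_inter IL JL eI eJ.
case mE : (smeet (Some I) (Some J)) (sset_meet (Some I) (Some J)) => [H|] HE.
  have {}HE : val H = (val I :&: val J)%SET := HE.
  have HI : isub H I by rewrite /isub HE finset.subsetIl.
  have HJ : isub H J by rewrite /isub HE finset.subsetIr.
  have HL := fintype.subset_trans HI IL.
  have /memv_imgP[h _ he] := eH H HE.
  (* By [kphi_range] the value of the section alone decides membership in the image of U_HL. *)
  have [w Dw wx] : (kphi H L @` kdom H L) (kphi I L x).
    by rewrite kphi_range//; exact: csH.
  exists (w, h); split=> //=.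
  + congr pair.
      apply: (kphi_inj IL) => //; last by rewrite kphi_comp.
      by apply/(kdom_phi HI IL) => //; exact: kdom_le Dw.
    by apply: (khat_inj IL); rewrite khat_comp.
  + congr pair.
      apply: (kphi_inj JL) => //; last by rewrite kphi_comp// wx.
      by apply/(kdom_phi HJ JL) => //; exact: kdom_le Dw.
    by apply: (khat_inj JL); rewrite khat_comp// -he.
have {}HE : (val I :&: val J)%SET = finset.set0 := esym HE.
have zx : cs (kK I) x = 0.
  by apply: (khat_inj IL); rewrite -cs_kphi// linear0 cs0.
have zy : cs (kK J) y = 0.
  by apply: (khat_inj JL); rewrite -cs_kphi// linear0 -xy cs0.
have ze : e = 0 by apply: (khat_inj IL); rewrite linear0 e0.
have zf : f = 0 by apply: (khat_inj JL); rewrite linear0 -ef e0.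
(* For disjoint I and J both points are zeros of their sections, and the common preimage is their
   point of the footprint in X. *)
exists (cpsi (kK I) x); split=> /=.
- exact/(kdom_zero IL).
- by rewrite cpsiK// ze.
- by rewrite zf -(cpsi_kphi IL Dx zx) xy (cpsi_kphi JL)// cpsiK.
Qed.

(** Only the union axiom is left. For nonempty g it is the first tameness identity; for empty g, a
    point of F_I and F_J shows that I u J is an index. *)
Lemma stratum_gluing : gluing sset smeet sdom sphi.
Proof.
split.
- exact: sset_inj.
- exact: sset_meet.
- exact: sdom_id.
- exact: sphi_id.
- exact: sdom_le.
- exact: sdom_phi.
- exact: sphi_comp.
- exact: sphi_inj.
- exact: sphi_open.
- exact: sphi_closed.
- exact: sphi_inter.
- move=> g i j w gi gj; case: i gi => [I|]; last first.
    by move=> g0 Dw Dw'; exists j; split=> //; rewrite /= finset.sub0set.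
  case: j gj => [J|]; last first.
    by move=> g0 gI Dw Dw'; exists (Some I); split=> //; rewrite /= finset.sub0set.
  case: g w => [H|] w HJ HI /= Dx Dy.
    case: tameK => _ /(_ H I J HI HJ)/seteqP[/(_ w.1 (conj Dx Dy)) + _] _.
    case=> L LE DL; exists (Some L); split=> //=; rewrite LE.
      exact: finset.subsetUl.
    exact: finset.subsetUr.
  move: Dx Dy; rewrite !footprintE => FI FJ.
  have FIJ : inter_footprint (kF K) (val I :|: val J)%SET w.
    by move=> i; rewrite finset.inE => /orP[/FI|/FJ].
  have LP : ((val I :|: val J)%SET != finset.set0) &&
      `[< inter_footprint (kF K) (val I :|: val J)%SET !=set0 >].
    rewrite finset.setU_eq0 negb_and val_neq0; apply/asboolP; by exists w.
  pose L : kidx K := exist _ (val I :|: val J)%SET LP.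
  exists (Some L); split=> /=.
  + exact: finset.subsetUl.
  + exact: finset.subsetUr.
  by rewrite footprintE.
Qed.

(** * Realizations *)

Lemma sdomain_hausdorff i : hausdorff_space (sdomain i).
Proof. by case: i => [I|] //; exact: bundle_hausdorff. Qed.

Lemma sdomain_normal i : normal_space (sdomain i).
Proof. by case: i => [I|]; [exact: bundle_normal|exact: compact_normal]. Qed.

Let bglued (z w : bundle_union K) : Prop :=
  @glued _ _ sset sdomain sdom sphi
    (Some (projT1 z)) (projT2 z) (Some (projT1 w)) (projT2 w).

Lemma pi_E_kphi I J x e : isub I J -> kdom I J x ->
  pi_E I (x, e : vtop (kE I)) = pi_E J (kphi I J x, khat I J e : vtop (kE J)).
Proof. by move=> IJ Dx; apply/gen_classP/rst_step; exact: BundleStep. Qed.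

(** Being glued is an equivalence relation containing the generating steps; conversely, a common
    image is reached by one step from each side. *)
Lemma bglued_classP (z w : bundle_union K) :
  gen_class (@bundle_step R X K) z = gen_class (@bundle_step R X K) w <->
  bglued z w.
Proof.
split=> [/gen_classP|].
  elim=> {z w} [_ _ [I J x e IJ Dx]|z|z w _|z w v _ zw _ wv].
  - exact: (glued_phi stratum_gluing (i := Some I) (j := Some J)).
  - exact: (glued_refl stratum_gluing).
  - exact: glued_sym.
  - exact: (glued_trans stratum_gluing) zw wv.
case: z w => [I [x e]] [J [y f]] [[L|] [/= IL JL Dx Dy xy]]; last first.
  by case: (not_sset_sub0 IL).
transitivity (pi_E L (kphi I L x, khat I L e : vtop (kE L))).
  exact: pi_E_kphi.
by rewrite xy; apply/esym; exact: pi_E_kphi.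
Qed.

Lemma pi_E_eq I J x e y f :
  pi_E I (x, e : vtop (kE I)) = pi_E J (y, f : vtop (kE J)) ->
  exists L, [/\ isub I L, isub J L, kdom I L x, kdom J L y &
    kphi I L x = kphi J L y /\ khat I L e = khat J L f].
Proof.
move/bglued_classP => -[[L|] [/= IL JL Dx Dy xy]]; last first.
  by case: (not_sset_sub0 IL).
by case: xy => xy ef; exists L.
Qed.

Lemma pi_E_inj I : injective (pi_E I).
Proof. by move=> x y /bglued_classP /(glued_same stratum_gluing). Qed.

Lemma pi_E_continuous I : continuous (pi_E I).
Proof.
move=> x; apply: continuous_comp; first exact: existT_continuous.
exact: pi_continuous.
Qed.

Lemma pi_K_continuous I : continuous (pi_K I).
Proof.
move=> x; apply: continuous_comp; first exact: existT_continuous.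
exact: pi_continuous.
Qed.

Lemma bundle_realization_hausdorff : hausdorff_space (bundle_realization K).
Proof.
apply: (@continuous_separation_hausdorff R) => p q pq.
have npq : ~ bglued (repr p) (repr q).
  by move/bglued_classP; rewrite !gen_class_repr.
have [f [cf fphi fpq]] := glued_separation stratum_gluing R
  sdomain_hausdorff sdomain_normal npq.
pose F (z : bundle_union K) : R := f (Some (projT1 z)) (projT2 z).
exists (fun q => F (repr q)) => //; apply: gen_quotient_continuous.
  by apply: sigT_continuous (fun I => cf (Some I)).
move=> _ _ [I J x e IJ Dx]; rewrite /F /=.
exact/esym/(fphi (Some I) (Some J) (x, e)).
Qed.

(** The saturated extension of an open set descends to an open set of the quotient, whose trace on
    the image of chart I is the image of the given set. *)
Lemma pi_E_homeo I : homeo_onto setT (range (pi_E I)) (pi_E I).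
Proof.
split.
- split=> [x _|x y _ _ /pi_E_inj//|//]; by exists x.
- exact/continuous_subspaceT/pi_E_continuous.
move=> O oO.
have [W [oW WI Wphi]] := glued_open_extension stratum_gluing (i := Some I) oO.
pose S : set (bundle_union K) := [set z | W (Some (projT1 z)) (projT2 z)].
have [oS SE] : open [set q : bundle_realization K | S (repr q)] /\
    forall z, S (repr (gen_class (@bundle_step R X K) z)) <-> S z.
  apply: gen_quotient_open; first by apply/sigT_openP => J; exact: (oW (Some J)).
  move=> _ _ [J L x e JL Dx].
  exact: (iff_sym (Wphi (Some J) (Some L) (x, e) JL Dx)).
exists [set q | S (repr q)] => //; rewrite setTI.
have SI x : S (repr (pi_E I x)) <-> O x by rewrite SE /S /= WI.
apply/seteqP; split=> [_ [x Ox <-]|q [[x _ <-] /SI Ox]].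
  by split; [exists x|apply/SI].
by exists x.
Qed.

(** Through this continuous section of [pr_K], separation, injectivity and open sets pass from the
    bundle to the base. *)
Definition zero_section (p : realization K) : bundle_realization K :=
  let z := repr p in pi_E (projT1 z) (projT2 z, 0).

Lemma zero_section_continuous : continuous zero_section.
Proof.
pose g (z : dom_union K) : bundle_realization K := pi_E (projT1 z) (projT2 z, 0).
apply: (@gen_quotient_continuous _ _ _ g).
  apply: (@sigT_continuous _ _ _ (fun I (x : kU I) => pi_E I (x, 0))) => I x.
  apply: (@continuous_comp _ _ _ (fun x : kU I => (x, 0) : bundle_dom I)).
    move=> A [[P Q] [/= Px Q0] PQ]; apply: filterS Px => y Py.
    by apply: PQ; split=> //=; exact: nbhs_singleton Q0.
  exact: pi_E_continuous.
by move=> _ _ [I J x IJ Dx]; rewrite /g /= (pi_E_kphi 0 IJ Dx) linear0.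
Qed.

Lemma pr_zero_section p : pr_K (zero_section p) = p.
Proof.
rewrite /zero_section pr_pi_E -[RHS]gen_class_repr.
by case: (repr p).
Qed.

Lemma zero_section_pi_K I x : zero_section (pi_K I x) = pi_E I (x, 0).
Proof.
apply: (gen_quotient_elim (g := fun z : dom_union K =>
  pi_E (projT1 z) (projT2 z, 0))) (existT _ I x).
by move=> _ _ [J L y JL Dy]; rewrite /= (pi_E_kphi 0 JL Dy) linear0.
Qed.

Lemma pi_K_eq I J x y : pi_K I x = pi_K J y ->
  exists L, [/\ isub I L, isub J L, kdom I L x, kdom J L y &
    kphi I L x = kphi J L y].
Proof.
move/(congr1 zero_section); rewrite !zero_section_pi_K.
by move/pi_E_eq => [L [? ? ? ? []]]; exists L.
Qed.

Lemma pi_K_inj I : injective (pi_K I).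
Proof.
move=> x y /(congr1 zero_section); rewrite !zero_section_pi_K.
by move/pi_E_inj => [].
Qed.

Lemma realization_hausdorff : hausdorff_space (realization K).
Proof.
move=> p q pq; apply: (can_inj pr_zero_section).
apply: bundle_realization_hausdorff => A B Ap Bq.
have [z [Az Bz]] := pq _ _ (zero_section_continuous Ap) (zero_section_continuous Bq).
by exists (zero_section z).
Qed.

Lemma pi_K_homeo I : homeo_onto setT (range (pi_K I)) (pi_K I).
Proof.
split.
- split=> [x _|x y _ _ /pi_K_inj//|//]; by exists x.
- exact/continuous_subspaceT/pi_K_continuous.
move=> O oO.
have oP : open (fst @^-1` O : set (bundle_dom I)).
  by apply: open_comp => // z _; exact: cvg_fst.
have [_ _ /(_ _ oP)[W oW WE]] := pi_E_homeo I.
exists (zero_section @^-1` W).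
  by move/continuousP: zero_section_continuous; apply.
rewrite setTI; apply/seteqP; split=> [_ [x Ox <-]|_ [[x _ <-]]].
  split; first by exists x.
  rewrite /= zero_section_pi_K.
  suff : (pi_E I @` ([set: bundle_dom I] `&` fst @^-1` O)) (pi_E I (x, 0)).
    by rewrite WE => -[].
  by exists (x, 0).
rewrite /= zero_section_pi_K => Wx.
have : (range (pi_E I) `&` W) (pi_E I (x, 0)) by split=> //; exists (x, 0).
by rewrite -WE => -[[y e] [_ /= Oy] /pi_E_inj[<- _]]; exists y.
Qed.

(** * Fibres *)

(** [L] has the largest size among the strata meeting the class. Any other representative has a
    common image with [z] in some U_M with M containing L, and maximality forces M = L. *)
Lemma maximal_stratum (p : realization K) : exists L (z : kU L), pi_K L z = p /\
  forall I x, pi_K I x = p -> [/\ isub I L, kdom I L x & kphi I L x = z].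
Proof.
pose Q n := `[< exists L (z : kU L), pi_K L z = p /\ #|val L| = n >].
have exQ : exists n, Q n.
  exists #|val (projT1 (repr p))|; apply/asboolP.
  exists (projT1 (repr p)), (projT2 (repr p)); split=> //.
  by rewrite -[RHS]gen_class_repr; case: (repr p).
have bQ n : Q n -> (n <= kN K)%N.
  by move=> /asboolP[L [z [_ <-]]]; rewrite -[leqRHS]card_ord max_card.
have [m /asboolP[L [z [zp mE]]] mmax] := ex_maxnP exQ bQ.
exists L, z; split=> // I x; rewrite -zp => /pi_K_eq[M [IM LM Dx Dz xz]].
have : (#|val M| <= m)%N.
  apply/mmax/asboolP; exists M, (kphi L M z); split=> //.
  by rewrite -zp; apply/esym/gen_classP/rst_step; exact: DomStep.
case: (isub_eqVlt LM) => [LE _|/proper_card + Mm]; last by rewrite mE ltnNge Mm.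
by subst M; move: xz; rewrite kphi_id => xz; split.
Qed.

Lemma fibre_inj (p : realization K) (q q' : fibre p) : sval q = sval q' -> q = q'.
Proof.
by case: q q' => [q e] [q' e'] /= E; subst q'; congr exist; exact: Prop_irrelevance.
Qed.

(** Carrying the proof [xp] places vectors from different charts in one type [fibre p]. *)
Definition fibre_at (p : realization K) I (x : kU I) (xp : pi_K I x = p)
    (e : kE I) : fibre p :=
  exist _ (pi_E I (x, e)) (etrans (pr_pi_E x e) xp).

(** Every vector over [p] moves to the maximal representative [z], and [pi_E] is injective on its
    chart. *)
Lemma fibre_chart (p : realization K) : exists L (z : kU L) (zp : pi_K L z = p),
  bijective (fibre_at zp) /\ forall I x (xp : pi_K I x = p) e,
    fibre_at xp e = fibre_at zp (khat I L e).
Proof.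
have [L [z [zp max]]] := maximal_stratum p; exists L, z, zp.
have fE I x (xp : pi_K I x = p) e : fibre_at xp e = fibre_at zp (khat I L e).
  have [IL Dx xz] := max I x xp.
  by apply: fibre_inj; rewrite /= (pi_E_kphi e IL Dx) xz.
split=> //.
have surj (q : fibre p) : exists e, fibre_at zp e = q.
  case: q => q qp; have := gen_class_repr q; case: (repr q) => [I [x e]] qE.
  have xp : pi_K I x = p by rewrite -qp -qE pr_pi_E.
  by exists (khat I L e); rewrite -(fE I x xp); exact: fibre_inj.
exists (fun q => sval (cid (surj q))) => [e|q]; last by case: cid.
by case: cid => e' /= /(congr1 sval) /= /pi_E_inj [].
Qed.

Lemma vect_ops_unique (T : Type) (E : vectType R) (m : E -> T) (V V' : vect_ops R T) :
  (forall t, exists e, m e = t) ->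
  is_vector_space V -> is_vector_space V' -> linear_to V m -> linear_to V' m ->
  V = V'.
Proof.
move=> msurj; have key W : is_vector_space W -> linear_to W m ->
    vzero W = m 0 /\ forall e, vopp W (m e) = m (- e).
  case=> -[A C Z N] _ _ _ _ [mD _].
  have z : vzero W = m 0.
    (* The element [m 0] is idempotent, hence neutral in the additive group. *)
    rewrite -(N (m 0)); have {2}-> : m 0 = vadd W (m 0) (m 0) by rewrite -mD addr0.
    by rewrite A N Z.
  split=> // e; rewrite -[LHS]Z z -(addNr e) mD -A [vadd W (m e) _]C N z.
  by rewrite -mD addr0.
move=> hV hV' lV lV'.
have [z o] := key V hV lV; have [z' o'] := key V' hV' lV'.
case: V V' lV lV' z o z' o' {hV hV'} => [Z A O S] [Z' A' O' S'] /=.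
move=> [/= D s] [/= D' s'] z o z' o'; congr VectOps.
- by rewrite z z'.
- apply/funext => t; apply/funext => u.
  by have [e <-] := msurj t; have [f <-] := msurj u; rewrite -D -D'.
- by apply/funext => t; have [e <-] := msurj t; rewrite o o'.
apply/funext => a; apply/funext => t; have [e <-] := msurj t.
by rewrite -s -s'.
Qed.

(** The structure is transported from E_L for the maximal L; the other charts enter through the
    linear maps [khat I L]. *)
Lemma fibre_vect_ops (p : realization K) : exists V : vect_ops R (fibre p),
  is_vector_space V /\
  forall I x (xp : pi_K I x = p), linear_to V (fibre_at xp).
Proof.
have [L [z [zp [[n mn nm] fE]]]] := fibre_chart p.
pose m := fibre_at zp; rewrite -/m in mn nm.
exists (VectOps (m 0) (fun q q' => m (n q + n q')) (fun q => m (- n q))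
  (fun a q => m (a *: n q))); split.
  split=> /=.
  - split=> [q q' q''|q q'|q|q] /=; rewrite ?mn ?nm.
    + by rewrite addrA.
    + by rewrite addrC.
    + by rewrite add0r nm.
    + by rewrite addNr.
  - by move=> q; rewrite scale1r nm.
  - by move=> a b q; rewrite mn scalerA.
  - by move=> a q q'; rewrite !mn scalerDr.
  - by move=> a b q; rewrite !mn scalerDl.
move=> I x xp.
by split=> [e e'|a e] /=; rewrite !(fE _ _ xp) -/m !mn ?linearD ?linearZ.
Qed.

Lemma fibre_vect_ops_unique : exists! V : forall p : realization K, vect_ops R (fibre p),
  (forall p, is_vector_space (V p)) /\
  (forall (I : kidx K) (x : kU I), linear_to (V (pi_K I x)) (fibre_map I x)).
Proof.
pose V p := sval (cid (fibre_vect_ops p)).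
have VV p : is_vector_space (V p) by rewrite /V; case: cid => W [].
have Vl p I x (xp : pi_K I x = p) : linear_to (V p) (fibre_at xp).
  by rewrite /V; case: cid => W [_ h] /=; exact: h.
have erE I x : fibre_at (erefl (pi_K I x)) = fibre_map I x.
  by apply/funext => e; exact: fibre_inj.
exists V; split; first by split=> // I x; rewrite -erE.
move=> W [WV Wl]; apply: functional_extensionality_dep => p.
have [L [z [zp [[n mn nm] _]]]] := fibre_chart p.
apply: (@vect_ops_unique _ _ (fibre_at zp)) => //.
- by move=> q; exists (n q); exact: nm.
- by subst p; rewrite erE.
Qed.
End Atlas.

Theorem proposition6p3p6 (R : realType) (X : topologicalType) (d : int)
    (K : kdata R X) :
  kuranishi_atlas d K \/ kuranishi_cobordism d K ->
  tame K ->
  [/\ hausdorff_space (realization K) /\ hausdorff_space (bundle_realization K),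
      forall I : kidx K,
        [/\ homeo_onto [set: kU I] (range (pi_K I)) (pi_K I),
            homeo_onto [set: bundle_dom I] (range (pi_E I))
              (pi_E I) &
            forall xe : bundle_dom I, pr_K (pi_E I xe) = pi_K I xe.1] &
      exists! V : forall p : realization K, vect_ops R (fibre p),
        (forall p, is_vector_space (V p)) /\
        (forall (I : kidx K) (x : kU I),
           linear_to (V (pi_K I x)) (fibre_map I x))].
Proof.
move=> AC tameK.
(* These facts are common to atlases and cobordisms and start the single argument for both. *)
have [hX cX hC oF [core chg]] : [/\ hausdorff_space X, compact [set: X],
    forall I : kidx K, chart_core (kK I),
    forall I : kidx K, open (footprint (kK I)) &
    atlas_core d K /\ forall I J : kidx K, ipsub I J ->
      coordinate_change (kdom I J) (kphi I J) (khat I J)].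
  have is_chart_open (C : chart R X) : is_chart setT C -> open (footprint C).
    by case=> _ _ _ [P oP ->]; rewrite setTI.
  case: AC => [[[cX mX] core ch chg]|[C [B [[cX cc] core ch chg _]]]].
    split=> //; first exact: metrizable_hausdorff mX.
    - by move=> I; have [] := ch I.
    - by move=> I; exact: is_chart_open.
  split=> //; first by case: cc => -[_ _ /metrizable_hausdorff].
  - by move=> I; case: (ch I) => [[[]]|[[]]].
  - by move=> I; case: (ch I) => [[[]]|[/is_chart_open]].
split.
- split.
    exact: (realization_hausdorff hX cX hC oF core chg tameK).
  exact: (bundle_realization_hausdorff hX cX hC oF core chg tameK).
- move=> I; split.
  + exact: (pi_K_homeo hC oF core chg tameK).
  + exact: (pi_E_homeo hC oF core chg tameK).
  + by case=> x e; exact: pr_pi_E.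
exact: (fibre_vect_ops_unique hC oF core chg tameK).
Qed.
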